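(* Let $\varphi$ be a tame recognisable substitution, let $N=1+\max_{u\in B}|u|$, and let $f_N:\Gamma_N\to\Gamma_N$ be the induced substitution map on the $N$-collared Anderson–Putnam complex of $\varphi$. There exists a positive integer $n$ such that for every closed invariant subspace $\Lambda\in\mathcal{C}$ of $\Omega_\varphi$ there exists a subcomplex $\Gamma_\Lambda\subset\Gamma_N$ such that $f_N^n(\Gamma_\Lambda)=\Gamma_\Lambda$ and $\varprojlim(\Gamma_\Lambda,f_N^n)$ is homeomorphic to $\Lambda$.
   Context: Substitutions. A substitution on a finite alphabet $\mathcal{A}$ is a function $\varphi:\mathcal{A}\to\mathcal{A}^+$ (non-empty finite words), extended by concatenation to words and to $\mathcal{A}^{\mathbb{Z}}$ (with the image of the letter at index $0$ starting at index $0$). A word is admitted if it is a subword of $\varphi^k(a)$ for some $a\in\mathcal{A}$, $k\ge0$. $X_\varphi$ is the set of $w\in\mathcal{A}^{\mathbb{Z}}$ all of whose finite subwords are admitted, with the subspace topology and shift $\sigma(w)_i=w_{i+1}$. A word is legal if it is a subword of an element of $X_\varphi$. A word $u\in\mathcal{A}^+$ is bounded if $\sup_n|\varphi^n(u)|<\infty$. $B$ is the set of bounded legal words; $\varphi$ is tame if $B$ is finite. If $B=\emptyset$ the maximum of $|u|$ over $B$ is taken to be $0$. Tiling space. $\Omega_\varphi=(X_\varphi\times[0,1])/{\sim}$ with $\sim$ generated by $(w,1)\sim(\sigma(w),0)$; points are written $(w,t)$ with $t\in[0,1)$. The continuous map $\varphi:\Omega_\varphi\to\Omega_\varphi$ is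 $\varphi(w,t)=(\sigma^{\lfloor\tilde t\rfloor}(\varphi(w)),\tilde t-\lfloor\tilde t\rfloor)$ with $\tilde t=|\varphi(w_0)|\,t$. $\varphi$ is recognisable if this map is injective. The flow is $\rho((w,t),\tau)=(\sigma^{\lfloor t+\tau\rfloor}(w),\,t+\tau \bmod 1)$, $\tau\in\mathbb{R}$. A closed invariant subspace (CIS) is a closed $\Lambda\subseteq\Omega_\varphi$ with $\rho(\Lambda,\tau)=\Lambda$ for all $\tau\in\mathbb{R}$; $\mathcal{C}$ is the set of all CISs. Collaring. Fix a letter $b\in\mathcal{A}$. For $n\ge0$, an $n$-collared letter $a_u$ is a word $u\in\mathcal{A}^{2n+1}$ together with its central letter $a$. Define $\varphi_n'$ on $\mathcal{A}^{2n+1}$: if $\varphi(a)=b_1\cdots b_k$, then $\varphi_n'(a_u)=(b_1)_{b_1(n)}\cdots(b_k)_{b_k(n)}$, where $b_i(n)$ is the length-$(2n+1)$ subword of $\varphi(u)$ centred at the letter $b_i$ of the block $\varphi(a)$ coming from the central letter of $u$. Let $\mathcal{A}_n'$ be the set of $a_u$ with $u$ legal, $\mathcal{A}_n''$ the set of $a_u$ with $u=b^n a b^n$ and $a$ an illegal letter, and $\mathcal{A}_n$ the set of $n$-collared letters appearing in $\varphi_n'^k(c_v)$ for some $k\ge0$ and $c_v\in\mathcal{A}_n'\cup\mathcal{A}_n''$. The $n$-collared substitution $\varphi_n$ on $\mathcal{A}_n$ is the restriction of $\varphi_n'$. Let $\iota_n:X_\varphi\to\mathcal{A}_n^{\mathbb{Z}}$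 replace each letter of $w$ by the $n$-collared letter given by the length-$(2n+1)$ subword of $w$ centred at it; it is a topological conjugacy onto $X_{\varphi_n}$, and we identify $\Omega_\varphi$ with $\Omega_{\varphi_n}$ via $(w,t)\mapsto(\iota_n(w),t)$. Anderson–Putnam complex. The Anderson–Putnam complex of a substitution $\varphi$ is the quotient of $\Omega_\varphi$ by the transitive closure of the relation: $(w,t)\sim(w',t')$ if $t=t'\in(0,1)$ and $w_0=w_0'$, or $t=t'=0$ and ($w_{-1}=w'_{-1}$ or $w_0=w_0'$). It is a finite graph with one edge for each legal letter and vertices the classes of points with $t=0$. $\Gamma_n$ is the Anderson–Putnam complex of $\varphi_n$, $p_n:\Omega_\varphi\cong\Omega_{\varphi_n}\to\Gamma_n$ is the quotient map, and $f_n:\Gamma_n\to\Gamma_n$ is the unique map with $f_n\circ p_n=p_n\circ\varphi$. $\varprojlim(\Gamma,f)=\{(x_0,x_1,\ldots): x_i\in\Gamma,\ f(x_{i+1})=x_i\ \forall i\}$. *)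

(* Defs.v *)
From HB Require Import structures.
From mathcomp Require Import all_boot all_order all_algebra zify.
From mathcomp Require Import boolp classical_sets functions cardinality fsbigop.
From mathcomp Require Import generic_quotient reals topology normedtype.
From Stdlib Require Import Relation_Operators.
Set Implicit Arguments. Unset Strict Implicit. Unset Printing Implicit Defensive.
Import Order.TTheory GRing.Theory Num.Theory.
Import numFieldNormedType.Exports.
Local Open Scope classical_set_scope.
Local Open Scope ring_scope.
Local Open Scope quotient_scope.

Record substitution (A : Type) := Substitution {
  subst_fun :> A -> seq A;
  subst_gt0 : forall a, (0 < size (subst_fun a))%N }.

Definition subst_word (A : Type) (phi : substitution A) (u : seq A) : seq A :=
  flatten (map phi u).

(* the word w_i w_(i+1) ... w_(i+m-1) *)
Definition window (A : Type) (w : int -> A) (i : int) (m : nat) : seq A :=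
  mkseq (fun j => w (i + j%:Z)) m.

Definition shift (A : Type) (k : int) (w : int -> A) : int -> A := fun i => w (i + k).

(* The image of w with the image of w_0 starting at index 0.  For k >= 0 the
   letter of index k is read in phi(w_0 ... w_k), which has length > k; the
   letter of index -(k+1), i.e. Negz k, is the k-th one from the right in
   phi(w_-(k+1) ... w_-1).  The default letter of nth is never reached. *)
Definition subst_bi (A : Type) (phi : substitution A) (w : int -> A) : int -> A :=
  fun i => match i with
  | Posz k => nth (w 0) (subst_word phi (window w 0 k.+1)) k
  | Negz k => nth (w 0) (rev (subst_word phi (window w (Negz k) k.+1))) k
  end.

Section Combi.
Variables (A : Type) (phi : substitution A).
Implicit Types (w : int -> A) (u v : seq A) (i : int) (m : nat).

Lemma subst_word_cat u v : subst_word phi (u ++ v) = subst_word phi u ++ subst_word phi v.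
Proof. by rewrite /subst_word map_cat flatten_cat. Qed.

Lemma size_subst_word u : (size u <= size (subst_word phi u))%N.
Proof.
rewrite /subst_word; elim: u => //= a u IH; rewrite size_cat.
by have := subst_gt0 phi a; lia.
Qed.

Lemma size_window w i m : size (window w i m) = m.
Proof. exact: size_mkseq. Qed.

Lemma nth_window x0 w i m j : (j < m)%N -> nth x0 (window w i m) j = w (i + j%:Z).
Proof. by move=> jm; rewrite nth_mkseq. Qed.

Lemma windowD w i m m' :
  window w i (m + m') = window w i m ++ window w (i + m%:Z) m'.
Proof.
rewrite /window /mkseq iotaD map_cat; congr (_ ++ _).
rewrite add0n -[X in iota X]addn0 iotaDl -map_comp; apply: eq_map => j /=.
by congr (w _); lia.
Qed.

Lemma window1 w i : window w i 1 = [:: w i].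
Proof. by rewrite /window /mkseq /= addr0. Qed.

Lemma shiftD w i j : shift i (shift j w) = shift (i + j) w.
Proof. by apply/funext => k; rewrite /shift addrA. Qed.

Lemma shift0 w : shift 0 w = w.
Proof. by apply/funext => k; rewrite /shift addr0. Qed.

Lemma window_shift w k i m : window (shift k w) i m = window w (i + k) m.
Proof. by apply: eq_map => j; rewrite /shift; congr (w _); lia. Qed.

Lemma window_map (T : Type) (f : A -> T) w i m :
  window (fun i => f (w i)) i m = map f (window w i m).
Proof. by rewrite /window /mkseq -map_comp. Qed.

Lemma subst_bi_pos x0 w m k : (k < size (subst_word phi (window w 0 m)))%N ->
  subst_bi phi w k%:Z = nth x0 (subst_word phi (window w 0 m)) k.
Proof.
have key m1 m2 : (m1 <= m2)%N -> (k < size (subst_word phi (window w 0 m1)))%N ->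
    nth x0 (subst_word phi (window w 0 m2)) k
    = nth x0 (subst_word phi (window w 0 m1)) k.
  by move=> /subnKC <- km; rewrite windowD subst_word_cat nth_cat km.
have kk : (k < size (subst_word phi (window w 0 k.+1)))%N.
  by apply: leq_trans (size_subst_word _); rewrite size_window.
move=> km /=; rewrite (set_nth_default x0)//.
by case: (leqP k.+1 m) => [/key->//|/ltnW/key->].
Qed.

Lemma subst_bi_neg x0 w m k :
    (k < size (subst_word phi (window w (- m%:Z) m)))%N ->
  subst_bi phi w (Negz k)
    = nth x0 (rev (subst_word phi (window w (- m%:Z) m))) k.
Proof.
have key m1 m2 : (m1 <= m2)%N ->
    (k < size (subst_word phi (window w (- m1%:Z) m1)))%N ->
    nth x0 (rev (subst_word phi (window w (- m2%:Z) m2))) k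
    = nth x0 (rev (subst_word phi (window w (- m1%:Z) m1))) k.
  move=> /subnK m12 km; rewrite -{2}m12 windowD subst_word_cat rev_cat nth_cat size_rev.
  have -> : - m2%:Z + (m2 - m1)%N%:Z = - m1%:Z by lia.
  by rewrite km.
have kk : (k < size (subst_word phi (window w (Negz k) k.+1)))%N.
  by apply: leq_trans (size_subst_word _); rewrite size_window.
move=> km /=; rewrite (set_nth_default x0) ?size_rev//.
move: kk; rewrite NegzE => kk.
by case: (leqP k.+1 m) => [/key->//|/ltnW/key->].
Qed.

Lemma subst_bi_shift1 w i :
  subst_bi phi (shift 1 w) i = subst_bi phi w (i + (size (phi (w 0)))%:Z).
Proof.
set L := size _; have x0 := w 0.
have sz0 : subst_word phi (window w 0 1) = phi (w 0).
  by rewrite window1 /subst_word /= cats0.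
case: i => k.
  rewrite (@subst_bi_pos x0 _ k.+1); last first.
    by apply: leq_trans (size_subst_word _); rewrite size_window.
  rewrite -PoszD (@subst_bi_pos x0 _ k.+2).
    rewrite (_ : k.+2 = 1 + k.+1)%N // windowD subst_word_cat nth_cat sz0.
    rewrite ifF; last by rewrite /L; lia.
    by rewrite window_shift /L addnK.
  rewrite (_ : k.+2 = 1 + k.+1)%N // windowD subst_word_cat size_cat sz0 addnC ltn_add2l.
  by apply: leq_trans (size_subst_word _); rewrite size_window.
have step : subst_word phi (window (shift 1 w) (- k.+1%:Z) k.+1) =
   subst_word phi (window w (- k%:Z) k) ++ phi (w 0).
  rewrite window_shift (_ : - k.+1%:Z + 1 = - k%:Z); last lia.
  by rewrite -addn1 windowD addNr subst_word_cat sz0.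
rewrite (@subst_bi_neg x0 _ k.+1); last first.
  by apply: leq_trans (size_subst_word _); rewrite size_window.
rewrite step rev_cat nth_cat size_rev -/L.
case: ltnP => kL.
  rewrite NegzE (_ : - k.+1%:Z + L%:Z = (L - k.+1)%N%:Z); last lia.
  rewrite (@subst_bi_pos x0 _ 1); last by rewrite sz0 -/L; lia.
  by rewrite sz0 nth_rev.
rewrite (_ : Negz k + L%:Z = Negz (k - L)); last by rewrite !NegzE; lia.
rewrite (@subst_bi_neg x0 _ k)//.
apply: leq_trans (size_subst_word _); rewrite size_window.
by have := subst_gt0 phi (w 0); rewrite -/L; lia.
Qed.

Lemma subst_bi_shift w m i :
  subst_bi phi (shift m%:Z w) i
    = subst_bi phi w (i + (size (subst_word phi (window w 0 m)))%:Z).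
Proof.
elim: m w i => [|m IH] w i; first by rewrite shift0 addr0.
rewrite (_ : m.+1%:Z = m%:Z + 1); last lia.
rewrite -shiftD IH subst_bi_shift1; congr (subst_bi _ _ _).
rewrite (_ : m.+1 = 1 + m)%N // windowD subst_word_cat size_cat window_shift.
by rewrite window1 /subst_word /= cats0 PoszD addrA addrAC.
Qed.

Lemma subst_bi_shiftN w m i :
  subst_bi phi w (i - (size (subst_word phi (window w (- m%:Z) m)))%:Z)
    = subst_bi phi (shift (- m%:Z) w) i.
Proof.
have := subst_bi_shift (shift (- m%:Z) w) m
  (i - (size (subst_word phi (window w (- m%:Z) m)))%:Z).
rewrite shiftD subrr shift0 => ->; congr (subst_bi _ _ _).
by rewrite window_shift add0r subrK.
Qed.

Lemma window_subst_bi w m :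
  window (subst_bi phi w) 0 (size (subst_word phi (window w 0 m)))
    = subst_word phi (window w 0 m).
Proof.
apply: (@eq_from_nth _ (w 0)) => [|k]; rewrite size_window // => km.
by rewrite nth_window // add0r (subst_bi_pos (w 0) km).
Qed.

Lemma block_ind (Q : (int -> A) -> int -> Prop) :
  (forall w j, (j < size (phi (w 0)))%N -> Q w j%:Z) ->
  (forall w j, Q (shift 1 w) j <-> Q w (j + (size (phi (w 0)))%:Z)) ->
  forall w j, Q w j.
Proof.
move=> H0 HS; have pos n w : Q w n%:Z.
  elim/ltn_ind: n w => n IH w.
  case: (ltnP n (size (phi (w 0)))) => [/H0//|nL].
  rewrite (_ : n%:Z = (n - size (phi (w 0)))%N%:Z + (size (phi (w 0)))%:Z); last by rewrite -PoszD subnK.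
  apply/HS/IH; rewrite ltn_subrL subst_gt0 /=.
  by apply: leq_trans nL; exact: subst_gt0.
have neg n w j : - n%:Z <= j -> Q w j.
  elim: n w j => [|n IH] w j nj.
    by rewrite (_ : j = `|j|%N%:Z) //; lia.
  have -> : w = shift 1 (shift (- 1) w) by rewrite shiftD subrr shift0.
  apply/HS/IH; rewrite /shift; have := subst_gt0 phi (w (0 - 1)).
  by move: (size _) => L; lia.
by move=> w j; apply: (neg `|j|%N); lia.
Qed.

End Combi.

Section Sub.
Variables (A : finType) (phi : substitution A).

Definition admitted (u : seq A) : Prop :=
  exists (a : A) (k : nat), infix u (iter k (subst_word phi) [:: a]).

Lemma iter_subst_cat k u v : iter k (subst_word phi) (u ++ v)
  = iter k (subst_word phi) u ++ iter k (subst_word phi) v.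
Proof. by elim: k => //= k ->; rewrite subst_word_cat. Qed.

Lemma infix_subst_word u v : infix u v -> infix (subst_word phi u) (subst_word phi v).
Proof.
by move=> /infixP[p [s ->]]; rewrite !subst_word_cat; apply/infixP; eexists; eexists.
Qed.

Lemma admitted_infix u v : infix u v -> admitted v -> admitted u.
Proof. by move=> uv [a [k vk]]; exists a, k; apply: infix_trans vk. Qed.

Lemma admitted_subst u : admitted u -> admitted (subst_word phi u).
Proof. by move=> [a [k uk]]; exists a, k.+1 => /=; apply: infix_subst_word. Qed.

Lemma infix_window (w : int -> A) i m i' m' :
  i' <= i -> i + m%:Z <= i' + m'%:Z -> infix (window w i m) (window w i' m').
Proof.
move=> h1 h2; apply/infixP; exists (window w i' `|i - i'|%N).
exists (window w (i + m%:Z) (m' - (`|i - i'|%N + m))).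
have iE : i' + `|i - i'|%N%:Z = i by lia.
have -> : m' = (`|i - i'|%N + (m + (m' - (`|i - i'|%N + m))))%N by lia.
by rewrite !windowD iE; congr (_ ++ (_ ++ window _ _ _)); lia.
Qed.

Lemma subst_bi_admitted (w : int -> A) :
  (forall i m, admitted (window w i m)) ->
  forall i m, admitted (window (subst_bi phi w) i m).
Proof.
move=> wX i m; pose M := (`|i| + m)%N.
pose s := size (subst_word phi (window w (- M%:Z) M)).
have sM : (M <= s)%N.
  by apply: leq_trans (size_subst_word _ _); rewrite size_window.
pose w' := shift (- M%:Z) w; pose u := window w (- M%:Z) (M + M).
have E : window (subst_bi phi w) i m = window (subst_bi phi w') (i + s%:Z) m.
  apply: eq_map => j; rewrite -subst_bi_shiftN -/s; congr (subst_bi _ _ _); lia.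
have uE : u = window w' 0 (M + M) by rewrite window_shift add0r.
apply: (@admitted_infix _ (subst_word phi u)); last exact/admitted_subst/wX.
rewrite E uE -window_subst_bi; apply: infix_window; first by lia.
rewrite -uE /u windowD subst_word_cat size_cat -/s.
have := size_subst_word phi (window w (- M%:Z + M%:Z) M); rewrite size_window.
have key (a L : nat) : (M <= a)%N -> (M <= L)%N ->
    i + a%:Z + m%:Z <= 0 + (a + L)%N%:Z by rewrite /M; lia.
exact: key.
Qed.

End Sub.

Section Sub.
Variables (A : finType) (phi : substitution A).

Definition subshift : set {ptws int -> discrete_topology A} :=
  [set w | forall i m, admitted phi (window w i m)].

Definition legal (u : seq A) : Prop :=
  exists2 w, subshift w & exists i, u = window w i (size u).

Definition bounded_word (u : seq A) : Prop :=
  u <> [::] /\ exists M : nat, forall k, (size (iter k (subst_word phi) u) <= M)%N.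

Definition bounded_legal : set (seq A) := [set u | bounded_word u /\ legal u].

Definition tame : Prop := finite_set bounded_legal.

(* for a tame substitution, the maximal length of a bounded legal word, and 0 if
   there is none *)
Definition max_bounded_legal : nat := \big[maxn/0%N]_(u \in bounded_legal) size u.

Lemma subshift_shift k w : subshift w -> subshift (shift k w).
Proof. by move=> wX i m; rewrite window_shift; exact: wX. Qed.

Lemma subshift_subst w : subshift w -> subshift (subst_bi phi w).
Proof. exact: subst_bi_admitted. Qed.
End Sub.

Section Collar.
Variables (A : Type) (n : nat).

(* the subword of length 2n+1 of w centred at index i *)
Definition collar (w : int -> A) (i : int) : (2 * n).+1.-tuple A :=
  [tuple w (i - n%:Z + (j : nat)%:Z) | j < (2 * n).+1].

Definition center (u : (2 * n).+1.-tuple A) : A := tnth u (inord n).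

Lemma center_collar w i : center (collar w i) = w i.
Proof. by rewrite /center tnth_mktuple inordK ?subrK//; lia. Qed.

Lemma collarE w i : collar w i = window w (i - n%:Z) (2 * n).+1 :> seq A.
Proof.
apply: (@eq_from_nth _ (w 0)) => [|j]; first by rewrite size_tuple size_window.
rewrite size_tuple => jn; rewrite nth_window//.
by rewrite -[j]/(nat_of_ord (Ordinal jn)) -tnth_nth tnth_mktuple.
Qed.

Lemma collar_shift k w : collar (shift k w) = shift k (collar w).
Proof.
apply/funext => i; apply: eq_from_tnth => j; rewrite !tnth_mktuple /shift.
by congr (w _); lia.
Qed.

Variable phi : substitution A.

(* The image of the central letter of u starts at index s in phi(u), and s >= n,
   so that the i-th letter of that block is the centre of the length-(2n+1)
   subword of phi(u) starting at s + i - n; here too nth never defaults. *)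
Definition collar_subst_fun (u : (2 * n).+1.-tuple A) : seq ((2 * n).+1.-tuple A) :=
  let s := size (subst_word phi (take n u)) in
  mkseq (fun i => [tuple nth (center u) (subst_word phi u) (s + i + j - n)
                  | j < (2 * n).+1]) (size (phi (center u))).

Fact collar_subst_gt0 u : (0 < size (collar_subst_fun u))%N.
Proof. by rewrite size_mkseq subst_gt0. Qed.

Definition collar_subst := Substitution collar_subst_gt0.

Lemma size_collar_subst w i : size (collar_subst (collar w i)) = size (phi (w i)).
Proof. by rewrite size_mkseq center_collar. Qed.

Lemma collar_subst_bi w : collar (subst_bi phi w) = subst_bi collar_subst (collar w).
Proof.
apply/funext; move: w.
apply: (@block_ind _ phi (fun w j => collar (subst_bi phi w) j = subst_bi collar_subst (collar w) j)).
  move=> w j jL; rewrite (@subst_bi_pos _ _ (collar w 0) _ 1); last first.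
    by rewrite window1 /subst_word /= cats0 size_collar_subst.
  rewrite window1 [subst_word _ [:: _]]/= /subst_word /= cats0.
  rewrite nth_mkseq ?center_collar//.
  apply: eq_from_tnth => t; rewrite !tnth_mktuple.
  set u := collar w 0.
  have uE : u = window w (- n%:Z) (2 * n).+1 :> seq A by rewrite /u collarE add0r.
  have tE : take n u = window w (- n%:Z) n.
    rewrite uE (_ : (2 * n).+1 = n + n.+1)%N; last lia.
    by rewrite windowD take_size_cat// size_window.
  rewrite tE.
  set s := size _.
  have ns : (n <= s)%N.
    by apply: leq_trans (size_subst_word phi _); rewrite size_window.
  have -> : j%:Z - n%:Z + (t : nat)%:Z = (s + j + t - n)%N%:Z - s%:Z by lia.
  rewrite subst_bi_shiftN (@subst_bi_pos _ _ (w 0) _ (2 * n).+1).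
    by rewrite window_shift add0r -uE.
  rewrite window_shift add0r.
  have -> : window w (- n%:Z) (2 * n).+1 = window w (- n%:Z) (n + (1 + n)).
    by congr window; lia.
  rewrite !windowD !subst_word_cat !size_cat -/s.
  rewrite !addNr !add0r /= addn0.
  have := size_subst_word phi (window w 1 n); rewrite size_window.
  have := ltn_ord t; move: (nat_of_ord t) => t'.
  move: jL; move: (size (phi _)) (size (subst_word _ _)) => L L'.
  by clear -ns; move: ns; clearbody s; lia.
move=> w j; rewrite collar_shift !subst_bi_shift1 size_collar_subst.
suff -> : collar (subst_bi phi (shift 1 w)) j = collar (subst_bi phi w) (j + (size (phi (w 0)))%:Z) by [].
apply: eq_from_tnth => t; rewrite !tnth_mktuple subst_bi_shift1.
by congr (subst_bi _ _ _); lia.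
Qed.

End Collar.

Lemma window_iter_subst (A : Type) (phi : substitution A) k (w : int -> A) m :
  window (iter k (subst_bi phi) w) 0 (size (iter k (subst_word phi) (window w 0 m)))
   = iter k (subst_word phi) (window w 0 m).
Proof.
elim: k => [|k IH] /=; first by rewrite size_window.
by rewrite -[in LHS]IH window_subst_bi IH.
Qed.

Lemma collar_iter_subst (A : Type) (phi : substitution A) n k (w : int -> A) m :
  iter k (subst_word (collar_subst n phi)) (window (collar n w) 0 m)
  = window (collar n (iter k (subst_bi phi) w)) 0
      (size (iter k (subst_word phi) (window w 0 m))).
Proof.
elim: k => [|k IH] /=; first by rewrite size_window.
have szE v i l : size (subst_word (collar_subst n phi) (window (collar n v) i l))
    = size (subst_word phi (window v i l)).
  rewrite /subst_word !size_flatten /shape -!map_comp; congr sumn.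
  by rewrite /window /mkseq -?map_comp; apply: eq_map => j /=; rewrite size_collar_subst.
by rewrite IH -window_subst_bi szE -collar_subst_bi window_iter_subst.
Qed.

Section Collared.
Variables (A : finType) (phi : substitution A) (b : A) (n : nat).

(* An n-collared letter is the tuple u itself, the letter a of a_u being
   [center u]. *)
Definition collared_seed (c : (2 * n).+1.-tuple A) : Prop :=
  legal phi c \/
  exists a, ~ legal phi [:: a] /\ c = nseq n b ++ a :: nseq n b :> seq A.

Definition is_collared (c : (2 * n).+1.-tuple A) : Prop :=
  exists v k, collared_seed v /\
    c \in iter k (subst_word (collar_subst n phi)) [:: v].

Definition collared_letter := {c : (2 * n).+1.-tuple A | `[< is_collared c >]}.

Lemma all_collared (c : collared_letter) :
  all (fun d => `[< is_collared d >]) (collar_subst n phi (val c)).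
Proof.
apply/allP => d dc; apply/asboolP.
have /asboolP[v [k [vs ck]]] := valP c; exists v, k.+1; split => //=.
by apply/flatten_mapP; exists (val c).
Qed.

(* Restriction of the collared substitution to the alphabet of collared letters:
   [insub] fails on none of the letters, see [map_val_collared_subst_fun]. *)
Definition collared_subst_fun (c : collared_letter) : seq collared_letter :=
  pmap insub (collar_subst n phi (val c)).

Lemma map_val_collared_subst_fun c :
  map val (collared_subst_fun c) = collar_subst n phi (val c).
Proof.
rewrite pmap_filter; last exact: insubK.
by rewrite (eq_filter (isSome_insub _)); apply/all_filterP/all_collared.
Qed.

Fact collared_subst_gt0 c : (0 < size (collared_subst_fun c))%N.
Proof. by rewrite -(size_map val) map_val_collared_subst_fun subst_gt0. Qed.

Definition collared_subst := Substitution collared_subst_gt0.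

Lemma map_val_collared_word k (u : seq collared_letter) :
  map val (iter k (subst_word collared_subst) u)
    = iter k (subst_word (collar_subst n phi)) (map val u).
Proof.
elim: k => //= k <-; rewrite /subst_word map_flatten -!map_comp.
by congr flatten; apply: eq_map => c /=; exact: map_val_collared_subst_fun.
Qed.

Lemma legal_collar w i : subshift phi w -> legal phi (collar n w i).
Proof. by move=> wX; exists w => //; exists (i - n%:Z); rewrite size_tuple collarE. Qed.

Lemma is_collared_collar w i : subshift phi w -> is_collared (collar n w i).
Proof.
move=> wX; exists (collar n w i), 0%N; split; last by rewrite inE.
by left; exact: legal_collar.
Qed.

Definition collared_word (w : subshift phi) (i : int) : collared_letter :=
  exist _ (collar n (val w) i) (asboolT (is_collared_collar i (set_valP w))).

Lemma ex_seed a : exists2 w : int -> A, w 0 = a & collared_seed (collar n w 0).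
Proof.
have [[w wX [i]]|na] := pselect (legal phi [:: a]).
  rewrite window1 => -[->]; exists (shift i w); first by rewrite /shift add0r.
  by left; apply/legal_collar/subshift_shift.
exists (fun i => if i == 0 then a else b) => //; right; exists a; split => //.
rewrite collarE (_ : (2 * n).+1 = n + (1 + n))%N; last lia.
rewrite !windowD window1 !add0r /= addNr /=; congr (_ ++ _ :: _).
  apply: (@eq_from_nth _ b) => [|j]; rewrite size_window ?size_nseq// => jn.
  by rewrite nth_window // nth_nseq jn /= ifF//; lia.
apply: (@eq_from_nth _ b) => [|j]; rewrite size_window ?size_nseq// => jn.
by rewrite nth_window // nth_nseq jn.
Qed.

Lemma window_infix_ex (w w' : int -> A) i m M u : (u : seq A) = window w 0 M ->
  infix (window w' i m) u ->
  exists2 k : nat, (k + m <= M)%N & window w' i m = window w k%:Z m.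
Proof.
move=> uE /infixP[p [s us]].
have sE : (size p + (m + size s) = M)%N.
  by rewrite -(size_window w 0 M) -uE us !size_cat size_window.
exists (size p); first lia.
move: us; rewrite uE -sE !windowD => /eqP.
rewrite eqseq_cat ?size_window// => /andP[_].
rewrite eqseq_cat ?size_window// => /andP[/eqP <- _].
by rewrite add0r.
Qed.

Fact collared_word_subshift w : subshift collared_subst (collared_word w).
Proof.
move=> i m.
have [a [k ak]] := set_valP w (i - n%:Z) (n + (m + n))%N.
have [W Wa seed] := ex_seed a.
pose Wk := iter k (subst_bi phi) W.
pose u := iter k (subst_word phi) [:: a].
have uE : u = window Wk 0 (size u) by rewrite /u -Wa -window1 window_iter_subst.
have cS : `[< is_collared (collar n W 0) >].
  by apply/asboolP; exists (collar n W 0), 0%N; split => //; rewrite inE.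
exists (exist _ (collar n W 0) cS), k.
suff : infix (map val (window (collared_word w) i m))
    (map val (iter k (subst_word collared_subst) [:: exist _ (collar n W 0) cS])).
  move=> /infixP[p [s ps]]; apply/infixP.
  set v := iter _ _ _ in ps *.
  exists (take (size p) v), (drop (size p + m) v).
  rewrite -[LHS](cat_take_drop (size p)); congr (_ ++ _).
  rewrite -[LHS](cat_take_drop m) drop_drop [(m + _)%N]addnC; congr (_ ++ _).
  apply: (inj_map val_inj); rewrite map_take map_drop ps drop_size_cat//.
  by rewrite take_size_cat// size_map size_window.
rewrite map_val_collared_word -window_map /=.
rewrite -(window1 (collar n W) 0) collar_iter_subst window1 Wa -/u.
have [j jm jE] := window_infix_ex uE ak.
have jE' t : (t < n + (m + n))%N -> val w (i - n%:Z + t%:Z) = Wk (j%:Z + t%:Z).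
  by move=> tn; rewrite -(nth_window b _ _ tn) jE nth_window.
rewrite (_ : window _ i m = window (collar n Wk) (j + n)%N m); last first.
  apply: (@eq_from_nth _ (collar n W 0)) => [|t]; rewrite ?size_window// => tm.
  rewrite !nth_window//; apply: eq_from_tnth => l; rewrite !tnth_mktuple.
  have := jE' (t + l)%N; rewrite (_ : i - n%:Z + (t + l)%N%:Z = i + t%:Z - n%:Z + l%:Z); last lia.
  rewrite (_ : j%:Z + (t + l)%N%:Z = (j + n)%N%:Z + t%:Z - n%:Z + l%:Z); last lia.
  by apply; have := ltn_ord l; lia.
by apply: infix_window; lia.
Qed.
End Collared.
Section QuotientBy.
Variables (T : topologicalType) (r : T -> T -> Prop).

Definition gen_rel : rel T := fun x y => `[< clos_refl_sym_trans T r x y >].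

Fact gen_rel_refl : ssrbool.reflexive gen_rel.
Proof. by move=> x; apply/asboolP; exact: rst_refl. Qed.

Fact gen_rel_sym : ssrbool.symmetric gen_rel.
Proof. by move=> x y; apply/asboolP/asboolP => h; exact: rst_sym. Qed.

Fact gen_rel_trans : ssrbool.transitive gen_rel.
Proof.
by move=> y x z /asboolP xy /asboolP yz; apply/asboolP; apply: rst_trans xy yz.
Qed.

Definition gen_equiv := EquivRel gen_rel gen_rel_refl gen_rel_sym gen_rel_trans.

Definition quotient_by : Type := {eq_quot gen_equiv}.

HB.instance Definition _ :=
  Topological.copy quotient_by (quotient_topology {eq_quot gen_equiv}).
HB.instance Definition _ := Quotient.on quotient_by.

Lemma quotient_by_eq x y : r x y -> \pi_quotient_by x = \pi_quotient_by y.
Proof. by move=> rxy; apply/eqmodP/asboolP; exact: rst_step. Qed.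

Lemma quotient_by_lift (Z : Type) (g : T -> Z) :
  (forall x y, r x y -> g x = g y) ->
  forall x, g (repr (\pi_quotient_by x)) = g x.
Proof.
move=> rg x.
have /eqmodP/asboolP : repr (\pi_quotient_by x) = x %[mod quotient_by] by rewrite reprK.
move: (repr _) => z; elim=> {z x} [u v|//|u v _ <-//|u v w _ -> _ ->//].
exact: rg.
Qed.

End QuotientBy.

Definition homeomorphic (X Y : topologicalType) : Prop :=
  exists (f : X -> Y) (g : Y -> X),
    [/\ cancel f g, cancel g f, continuous f & continuous g].

(* inverse limit of the single bonding map f restricted to S, as a subspace of
   the product of countably many copies of T *)
Definition inverse_limit (T : topologicalType) (f : T -> T) (S : set T) :
    set {ptws nat -> T} :=
  [set x | forall i, S (x i) /\ f (x i.+1) = x i].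

Section TilingSpace.
Variables (R : realType) (A : finType) (phi : substitution A).

(* [set_type] carries the subspace topology *)
Definition suspension := (subshift phi * `[0 : R, 1]%classic)%type.

Definition glue (x y : suspension) : Prop :=
  [/\ val x.2 = 1, val y.1 = shift 1 (val x.1) & val y.2 = 0].

Definition tiling_space := quotient_by glue.

Definition shiftX (k : int) (w : subshift phi) : subshift phi :=
  SigSub (mem_set (subshift_shift k (set_valP w))).

Definition substX (w : subshift phi) : subshift phi :=
  SigSub (mem_set (subshift_subst (set_valP w))).

Fact frac_proof (s : R) : `[0 : R, 1]%classic (s - (Num.floor s)%:~R).
Proof.
rewrite /= in_itv /= subr_ge0 floor_le lerBlDr addrC ltW//.
by rewrite -[X in _ + X]/(1%:~R) -intrD floorD1_gt.
Qed.

Definition frac (s : R) : `[0 : R, 1]%classic :=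
  SigSub (mem_set (frac_proof s)).

(* the point of the suspension reached from (w, 0) after time s *)
Definition position (w : subshift phi) (s : R) : suspension :=
  (shiftX (Num.floor s) w, frac s).

(* [tiling_map] and [flow] compute with an arbitrary representative; the result
   does not depend on it, see [tiling_mapE] and [flowE]. *)
Definition tiling_map (x : tiling_space) : tiling_space :=
  let: (w, t) := repr x in
  \pi_tiling_space (position (substX w) ((size (phi (val w 0)))%:R * val t)).

Definition flow (x : tiling_space) (tau : R) : tiling_space :=
  let: (w, t) := repr x in \pi_tiling_space (position w (val t + tau)).

Lemma position_shift w s : position (shiftX 1 w) s = position w (s + 1).
Proof.
have e : Num.floor (s + 1) = Num.floor s + 1 by rewrite floorDrz ?floor1 ?rpred1.
congr (_, _); apply: val_inj => /=; rewrite e.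
  by rewrite shiftD.
by rewrite intrD opprD addrACA subrr addr0.
Qed.
Lemma position_nat w (k : nat) : position w k%:R = (shiftX k%:Z w, frac 0).
Proof.
have e : Num.floor (k%:R : R) = k%:Z by rewrite -[k%:R]/(k%:Z%:~R) intrKfloor.
congr (_, _); apply: val_inj => /=; rewrite e//.
by rewrite floor0 !subrr.
Qed.

Lemma flowE w t tau :
  flow (\pi_tiling_space (w, t)) tau = \pi_tiling_space (position w (val t + tau)).
Proof.
rewrite /flow.
have := @quotient_by_lift _ glue _ (fun x => \pi_tiling_space (position x.1 (val x.2 + tau))).
move=> /(_ _ (w, t)) <-; first by case: repr.
move=> [{}w [t1 ?]] [w' [t0 ?]] [/= -> e ->].
have -> : w' = shiftX 1 w by apply: val_inj.
by rewrite position_shift add0r addrC.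
Qed.

Lemma tiling_mapE w t : tiling_map (\pi_tiling_space (w, t)) =
  \pi_tiling_space (position (substX w) ((size (phi (val w 0)))%:R * val t)).
Proof.
rewrite /tiling_map.
have := @quotient_by_lift _ glue _ (fun x => \pi_tiling_space
  (position (substX x.1) ((size (phi (val x.1 0)))%:R * val x.2))).
move=> /(_ _ (w, t)) <-; first by case: repr.
move=> [{}w [t1 ?]] [w' [t0 ?]] [/= -> e ->].
have -> : w' = shiftX 1 w by apply: val_inj.
rewrite mulr1 mulr0 -[0]/(0%:R) !position_nat; congr (\pi_tiling_space (_, _)).
by apply: val_inj; apply/funext => i; rewrite /= shift0 subst_bi_shift1.
Qed.

Definition recognisable : Prop := injective tiling_map.

Definition closed_invariant (L : set tiling_space) : Prop :=
  closed L /\ forall tau, (flow ^~ tau) @` L = L.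

(* [ap_rel] is reflexive and symmetric ([ap_rel_refl], [ap_rel_sym]), so the
   equivalence relation it generates is its transitive closure. *)
Definition ap_rel (x y : tiling_space) : Prop :=
  exists w w' (t : `[0 : R, 1]%classic),
    [/\ x = \pi_tiling_space (w, t), y = \pi_tiling_space (w', t), val t < 1 &
        (0 < val t /\ val w 0 = val w' 0) \/
        (val t = 0 /\ (val w (-1) = val w' (-1) \/ val w 0 = val w' 0))].

Definition ap_complex := quotient_by ap_rel.

Definition ap_point (w : subshift phi) (t : `[0 : R, 1]%classic) : ap_complex :=
  \pi_ap_complex (\pi_tiling_space (w, t)).

Definition ap_edge (a : A) : set ap_complex :=
  [set x | exists w t, val w 0 = a /\ x = ap_point w t].

Definition ap_vertex : set ap_complex :=
  [set x | exists w t, val t = 0 /\ x = ap_point w t].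

(* A subcomplex is a union of closed edges (with their endpoints) and vertices;
   [ap_edge a] is empty when the letter a is not legal. *)
Definition subcomplex (S : set ap_complex) : Prop :=
  exists (E : set A) (V : set ap_complex),
    V `<=` ap_vertex /\ S = \bigcup_(a in E) ap_edge a `|` V.

Lemma tiling_spaceP (x : tiling_space) :
  exists w (t : `[0 : R, 1]%classic), x = \pi_tiling_space (w, t) /\ val t < 1.
Proof.
rewrite -[x]reprK; case: (repr x) => w t.
have := set_valP t; rewrite /= in_itv /= => /andP[_].
rewrite le_eqVlt => /predU1P[t1|t1]; last by exists w, t.
exists (shiftX 1 w), (frac 0); split; last by rewrite /= floor0 subrr.
by apply: quotient_by_eq; split => //=; rewrite floor0 subrr.
Qed.

Lemma frac_lt1 s : val (frac s) < 1.
Proof. by rewrite /= ltrBlDr addrC -[X in _ + X]/(1%:~R) -intrD floorD1_gt. Qed.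

Lemma ap_rel0 (w w' : subshift phi) s : val w 0 = val w' 0 ->
  ap_rel (\pi_tiling_space (w, frac s)) (\pi_tiling_space (w', frac s)).
Proof.
move=> ww'; exists w, w', (frac s); split => //; first exact: frac_lt1.
have : 0 <= val (frac s) by rewrite /= subr_ge0 floor_le.
by rewrite le_eqVlt => /predU1P[<-|?]; [right; split => //; right|left].
Qed.

Lemma ap_rel_refl x : ap_rel x x.
Proof.
have [w [t [-> t1]]] := tiling_spaceP x; exists w, w, t; split => //.
have := set_valP t; rewrite /= in_itv /= => /andP[+ _].
by rewrite le_eqVlt => /predU1P[<-|?]; [right; split => //; right|left].
Qed.

Lemma ap_rel_sym x y : ap_rel x y -> ap_rel y x.
Proof.
move=> [w [w' [t [-> -> t1 h]]]]; exists w', w, t; split => //.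
by case: h => [[? ->]|[? [] ->]]; [left|right; split => //; left|right; split => //; right].
Qed.

Lemma ap_rel_map x y : ap_rel x y -> ap_rel (tiling_map x) (tiling_map y).
Proof.
have key (w w' : subshift phi) k : val w 0 = val w' 0 ->
    (k < size (phi (val w 0)))%N -> subst_bi phi (val w) k%:Z = subst_bi phi (val w') k%:Z.
  move=> ww' kL.
  have E u : subst_word phi (window u 0 1) = phi (u 0).
    by rewrite window1 /subst_word /= cats0.
  by rewrite !(@subst_bi_pos _ _ (val w 0) _ 1) ?E -?ww'.
move=> [w [w' [t [-> -> t1 h]]]]; rewrite !tiling_mapE.
have t0 : 0 <= val t by have := set_valP t; rewrite /= in_itv /= => /andP[].
have [ww'|ww'] : val w 0 = val w' 0 \/
    val t = 0 /\ val w (-1) = val w' (-1) by tauto.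
  rewrite -ww'; apply: ap_rel0 => /=; rewrite /shift add0r.
  set L := size _; set s := _ * _.
  have s0 : 0 <= s by rewrite mulr_ge0.
  have sL : s < L%:R by rewrite gtr_pMr// ltr0n subst_gt0.
  have f0 : 0 <= Num.floor s by rewrite floor_ge0.
  have fL : Num.floor s < L%:Z by rewrite floor_lt_int.
  by case: (Num.floor s) f0 fL => // k _ kL; apply: key.
have [tt0 w1] := ww'; rewrite tt0 !mulr0.
exists (substX w), (substX w'), (frac 0).
have e u : position u 0 = (u, frac 0).
  rewrite -[X in position _ X]/(0%:R) position_nat; congr (_, _).
  by apply: val_inj; rewrite /= shift0.
split; rewrite ?e//; first exact: frac_lt1.
right; split; first by rewrite /= floor0 subrr.
left; have E u : phi (u (-1)) = subst_word phi (window u (- 1%N%:Z) 1).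
  by rewrite window1 /subst_word /= cats0.
have H (u : subshift phi) :
    val (substX u) (-1) = nth (val w 0) (rev (phi (val u (-1)))) 0.
  have -> : val (substX u) (-1) = subst_bi phi (val u) (Negz 0) by [].
  by rewrite (@subst_bi_neg _ _ (val w 0) _ 1) -E ?subst_gt0.
by rewrite !H w1.
Qed.

Lemma ap_map_ex : exists f : ap_complex -> ap_complex,
  forall x, f (\pi_ap_complex x) = \pi_ap_complex (tiling_map x).
Proof.
exists (fun y => \pi_ap_complex (tiling_map (repr y))) => x.
apply: (@quotient_by_lift _ ap_rel _ (fun z => \pi_ap_complex (tiling_map z))).
by move=> {}x y /ap_rel_map; exact: quotient_by_eq.
Qed.

End TilingSpace.

Section CollaredComplex.
Variables (R : realType) (A : finType) (phi : substitution A) (b : A) (n : nat).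

Let phin := collared_subst phi b n.

Definition collared_wordX (w : subshift phi) : subshift phin :=
  SigSub (mem_set (collared_word_subshift b n w)).

Definition collar_iso (x : tiling_space R phi) : tiling_space R phin :=
  let: (w, t) := repr x in \pi_(tiling_space R phin) (collared_wordX w, t).

Definition collared_complex := ap_complex R phin.

Definition ap_proj (x : tiling_space R phi) : collared_complex :=
  \pi_collared_complex (collar_iso x).

Lemma collared_wordX_shift k w :
  collared_wordX (shiftX k w) = shiftX k (collared_wordX w).
Proof.
apply: val_inj; apply/funext => i; apply: val_inj => /=.
by rewrite collar_shift.
Qed.

Lemma collared_wordX_subst w :
  collared_wordX (substX w) = substX (collared_wordX w).
Proof.
apply: val_inj; apply/funext => i; apply: val_inj => /=.
rewrite collar_subst_bi; set W : int -> collared_letter phi b n := collared_word b n w.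
have E j m : map val (subst_word phin (window W j m))
    = subst_word (collar_subst n phi) (window (collar n (val w)) j m).
  by rewrite (map_val_collared_word 1) -window_map.
case: i => k /=.
  rewrite -E (nth_map (W 0))//.
  by apply: leq_trans (size_subst_word _ _); rewrite size_window.
rewrite -E -map_rev (nth_map (W 0))// size_rev.
by apply: leq_trans (size_subst_word _ _); rewrite size_window.
Qed.

Lemma collar_isoE w t : collar_iso (\pi_(tiling_space R phi) (w, t)) =
  \pi_(tiling_space R phin) (collared_wordX w, t).
Proof.
rewrite /collar_iso.
have := @quotient_by_lift _ (@glue R A phi) _
  (fun x => \pi_(tiling_space R phin) (collared_wordX x.1, x.2)).
move=> /(_ _ (w, t)) <-; first by case: repr.
move=> [{}w t1] [w' t0] [/= e1 e e0].
have -> : w' = shiftX 1 w by apply: val_inj.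
apply: quotient_by_eq; split => //.
by rewrite [LHS](congr1 val (collared_wordX_shift 1 w)).
Qed.

Lemma collar_iso_map x : collar_iso (tiling_map x) = tiling_map (collar_iso x).
Proof.
have [w [t [-> _]]] := tiling_spaceP x.
have e : size (phin (val (collared_wordX w) 0)) = size (phi (val w 0)).
  by rewrite -(size_map val) map_val_collared_subst_fun size_collar_subst.
rewrite collar_isoE !tiling_mapE e /position collar_isoE.
by rewrite -collared_wordX_subst -collared_wordX_shift.
Qed.

Lemma collared_wordX_surj z : exists w, collared_wordX w = z.
Proof.
pose w : int -> A := fun i => center (val (val z i)).
have key i m : exists (V : int -> A) (t : int), admitted phi (window V t m) /\
    forall l, (l < m)%N -> val (val z (i + l%:Z)) = collar n V (t + l%:Z).
  have [c [k ck]] := set_valP z i m.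
  pose V (j : int) := nth b (val c) `|(j + n%:Z)%R|%N.
  have Vc : val c = collar n V 0.
    apply: eq_from_tnth => l; rewrite tnth_mktuple (tnth_nth b) /V.
    by congr nth; lia.
  have : infix (map val (window (val z) i m))
      (map val (iter k (subst_word phin) [:: c])).
    by move/infixP: ck => [p [s ->]]; rewrite !map_cat; apply/infixP; exists (map val p), (map val s).
  rewrite map_val_collared_word /= Vc -(window1 (collar n V) 0) collar_iter_subst.
  set Vk := iter k _ V; rewrite window1 -window_map.
  move=> /(window_infix_ex erefl)[t tm tE]; exists Vk, t%:Z; split.
    exists (V 0), k.
    rewrite -(window1 V 0) -window_iter_subst window1; apply: infix_window; lia.
  move=> l lm; have := congr1 (fun s => nth (collar n V 0) s l) tE.
  by rewrite !nth_window.
have wX : subshift phi w.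
  move=> i m; have [V [t [adm E]]] := key i m.
  rewrite (_ : window w i m = window V t m)//.
  apply: (@eq_from_nth _ b) => [|l]; rewrite ?size_window// => lm.
  by rewrite !nth_window// /w E// center_collar.
exists (SigSub (mem_set wX)); apply: val_inj; apply/funext => i; apply: val_inj => /=.
have [V [t [_ E]]] := key (i - n%:Z) (2 * n).+1.
have := E n; rewrite subrK => -> //; last lia.
apply: eq_from_tnth => l; rewrite !tnth_mktuple /w E//.
by rewrite center_collar; congr V; lia.
Qed.

Lemma ap_proj_surj y : exists x, ap_proj x = y.
Proof.
have [z [t [e _]]] := tiling_spaceP (repr y).
have [w wz] := collared_wordX_surj z.
exists (\pi_(tiling_space R phi) (w, t)).
by rewrite /ap_proj collar_isoE wz -e reprK.
Qed.

Lemma induced_map_ex : exists f : collared_complex -> collared_complex,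
  f \o ap_proj = ap_proj \o @tiling_map R A phi.
Proof.
have [f fE] := ap_map_ex R phin; exists f.
by apply/funext => x /=; rewrite /ap_proj fE collar_iso_map.
Qed.

(* the unique map f with f \o ap_proj = ap_proj \o tiling_map, see
   [induced_map_unique] *)
Definition induced_map : collared_complex -> collared_complex :=
  sval (cid induced_map_ex).

Lemma induced_mapE : induced_map \o ap_proj = ap_proj \o @tiling_map R A phi.
Proof. exact: svalP (cid induced_map_ex). Qed.

Lemma induced_map_unique f :
  f \o ap_proj = ap_proj \o @tiling_map R A phi -> f = induced_map.
Proof.
rewrite -induced_mapE => e; apply/funext => y; have [x <-] := ap_proj_surj y.
by move/(congr1 (@^~ x)): e.
Qed.

End CollaredComplex.

(* Main.v *)
From mathcomp Require Import all_boot all_order all_algebra zify.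
From mathcomp Require Import boolp classical_sets functions cardinality fsbigop.
From mathcomp Require Import generic_quotient reals topology normedtype.
Require Import Defs.
Set Implicit Arguments. Unset Strict Implicit. Unset Printing Implicit Defensive.
Import Order.TTheory GRing.Theory Num.Theory.
Import numFieldNormedType.Exports.
Local Open Scope classical_set_scope.
Local Open Scope ring_scope.
Local Open Scope quotient_scope.

(** Write Phi for the substitution map on the tiling space Omega, p for the
    projection of Omega onto the collared complex and f for the induced map, so
    that f \o p = p \o Phi.

    Phi is a self-homeomorphism of the compact Hausdorff space Omega: it is
    continuous ([tiling_map_continuous]), injective by recognisability, and onto
    because by compactness every sequence of the subshift can be desubstituted
    ([substX_onto]).  A point x therefore has the whole backward orbit
    (p x, p (Phi^-1 x), p (Phi^-2 x), ...) in the complex.  Taking every m-th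
    term gives a continuous map H from Omega to the inverse limit of f^m.

    H is injective for every m > 0 because the collared substitution forces its
    border.  If p y = p y', then y and y' have the same N letters on each side
    of the tile at the origin, or of the vertex at the origin.  As N exceeds the
    length of every bounded legal word ([legal_growth]), the images of both
    collars under Phi^k become arbitrarily long, so Phi^k y and Phi^k y' agree on
    arbitrarily large neighbourhoods of the origin ([border_forcing]).  Points whose backward orbits have the same
    projections are then equal ([border_forcing_inj]).

    For a closed invariant L let E_k be the projection of Phi^-k(L).  Preimages
    of L are unions of flow orbits, so E_k is a union of closed edges and takes
    finitely many values; moreover f(E_(k+1)) = E_k.  A backward orbit in a
    finite set is periodic, and the factorial of the size of that set is a
    period that depends neither on L nor on k ([backward_periodic]).  With m
    this period, S = E_0 satisfies f^m(S) = S, and H maps L into the inverse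
    limit of S since E_(mk) = S for all k.  It maps onto it: if y is in the
    inverse limit, write y_k = p(z_k) with Phi^(mk)(z_k) in L; any cluster point
    of the points Phi^(mk)(z_k) is sent to y.  An injective continuous map from
    a compact space to a Hausdorff space restricts to a homeomorphism from L
    onto its image, whence the theorem. *)

(** * Compact and Hausdorff spaces *)

(** The quotient spaces below are shown to be Hausdorff through this criterion,
    with explicit real functions, since quotients of Hausdorff spaces need not
    be Hausdorff. *)
Lemma separated_hausdorff (T : topologicalType) :
  (forall x y : T, x <> y -> exists (Y : topologicalType) (g : T -> Y),
     [/\ hausdorff_space Y, continuous g & g x <> g y]) ->
  hausdorff_space T.
Proof.
move=> sep x y xy; apply: contrapT => /sep[Y [g [hY cg]]]; apply.
apply: hY => U V Ux Vy.
have [z [Uz Vz]] := xy _ _ (cg x _ Ux) (cg y _ Vy).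
by exists (g z).
Qed.

Lemma compact_set_type (T : topologicalType) (K : set T) :
  compact K -> compact [set: K].
Proof.
move=> cK F FF _.
have FK : (set_val @ F) K by apply: (@filterE _ F) => y; exact: set_valP.
have [x [Kx xF]] := cK (set_val @ F) _ FK.
exists (SigSub (mem_set Kx)); split => // U V FU.
rewrite nbhsE => -[_ [[W oW <-] /= Wx] WV].
have FU' : (set_val @ F) (set_val @` U) by apply: (@filterS _ F _ U) => // y Uy; exists y.
have nW : nbhs x W by exact: open_nbhs_nbhs (conj oW Wx).
have [_ [[y Uy <-] Wy]] := xF _ _ FU' nW.
by exists y; split => //; apply: WV.
Qed.

Lemma closed_map_compact (T Y : topologicalType) (g : T -> Y) :
  compact [set: T] -> hausdorff_space Y -> continuous g ->
  forall D, closed D -> closed (g @` D).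
Proof.
move=> cT hY cg D cD; apply: compact_closed => //.
apply: continuous_compact; first exact: continuous_subspaceT.
exact: subclosed_compact cD cT _.
Qed.

Lemma continuous_inverse_compact (T Y : topologicalType) (g : T -> Y) (h : Y -> T) :
  compact [set: T] -> hausdorff_space Y -> continuous g ->
  cancel g h -> cancel h g -> continuous h.
Proof.
move=> cT hY cg gK hK; apply/continuous_closedP => D cD.
suff -> : h @^-1` D = g @` D by exact: closed_map_compact.
by apply/seteqP; split=> [y Dy|_ [x Dx <-]] /=; [exists (h y)|rewrite gK].
Qed.

(** Both sides carry the subspace topology.  The inverse is continuous because g
    is a closed map: a closed subset of D has a compact image in Y. *)
Lemma homeomorphic_image (T Y : topologicalType) (g : T -> Y) (D : set T) (E : set Y) :
  compact [set: T] -> hausdorff_space Y -> continuous g -> injective g ->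
  closed D -> g @` D = E -> homeomorphic E D.
Proof.
move=> cT hY cg gI cD gE.
have h1 (y : E) : exists x : D, g (set_val x) = set_val y.
  by have := set_valP y; rewrite -{1}gE => -[x Dx gx]; exists (SigSub (mem_set Dx)).
have h2 (x : D) : E (g (set_val x)).
  by rewrite -gE; exists (set_val x) => //; exact: set_valP.
pose G (x : D) : E := SigSub (mem_set (h2 x)).
pose H (y : E) : D := sval (cid (h1 y)).
have HK y : g (set_val (H y)) = set_val y by exact: svalP (cid (h1 y)).
exists H, G; split.
- by move=> y; apply: val_inj; rewrite /= HK.
- by move=> x; apply: val_inj; apply: gI; rewrite HK.
- apply/continuous_closedP => C; rewrite -openC => -[W oW WC].
  have -> : H @^-1` C = set_val @^-1` (g @` (D `&` ~` W)).
    apply/seteqP; split=> y /=.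
      move=> Cy; exists (set_val (H y)); last by rewrite HK.
      split; first exact: set_valP.
      by move=> Wy; have : (~` C) (H y) by rewrite -WC.
    move=> [x [Dx nWx] gx]; have -> : H y = SigSub (mem_set Dx).
      by apply: val_inj; apply: gI; rewrite HK gx.
    apply: contrapT => nC; apply: nWx.
    by have : (~` C) (SigSub (mem_set Dx)) by []; rewrite -WC.
  move/continuous_closedP: (@initial_continuous E Y set_val); apply.
  apply: closed_map_compact => //; apply: closedI => //.
  by rewrite closedC.
- apply: continuous_comp_initial.
  have -> : set_val \o G = g \o set_val by [].
  move=> x; apply: continuous_comp; first exact: initial_continuous.
  exact: cg.
Qed.

(** * Sequences and subshifts *)

Lemma continuous_ptws (T : topologicalType) (I : Type) (Y : topologicalType)
    (F : T -> {ptws I -> Y}) :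
  (forall i, continuous (fun x => F x i)) -> continuous F.
Proof.
move=> cF x; apply/cvg_sup => i U [_ [[W oW <-] Wx WU]].
exact: filterS (fun y => WU (F y)) (cF i x _ (open_nbhs_nbhs (conj oW Wx))).
Qed.

Section Agree.
Variable T : Type.
Implicit Types w : int -> T.

Definition agree (r : nat) w w' := forall i : int, (`|i| <= r)%N -> w i = w' i.

Lemma agree_window r w w' (i : int) m :
  (`|i| <= r)%N -> (`|(i + m%:Z)%R| <= r)%N -> agree r w w' -> window w i m = window w' i m.
Proof.
move=> ir imr ww'; apply: (@eq_from_nth _ (w 0)); rewrite !size_window// => j jm.
by rewrite !nth_window// ww'//; lia.
Qed.

End Agree.

Lemma near_agree_ptws (T : choiceType) (w : {ptws int -> discrete_topology T}) r :
  \forall w' \near w, agree r w w'.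
Proof.
have near1 i : \forall w' \near w, w i = w' i.
  have := @proj_continuous int (fun=> discrete_topology T) i w.
  move=> /(_ [set w i] (discrete_set1 _)).
  by apply: (@filterS _ (nbhs w)) => w' /= <-.
have := @filter_forall _ 'I_(2 * r).+1
  (fun k w' => w (k%:Z - r%:Z) = w' (k%:Z - r%:Z)) (nbhs w) _ (fun k => near1 _).
move=> /(_ (nbhs_filter w)); apply: (@filterS _ (nbhs w)) => w' ww' i ir.
have ik : (`|(i + r%:Z)%R| < (2 * r).+1)%N by lia.
by have := ww' (Ordinal ik); rewrite /= (_ : _ - r%:Z = i)//; lia.
Qed.

Lemma ptws_compact (T : finType) : compact [set: {ptws int -> discrete_topology T}].
Proof.
have := @tychonoff int (fun=> discrete_topology T) (fun=> setT).
rewrite (_ : [set f | _] = setT); last by apply/seteqP; split.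
apply=> i; apply: finite_compact; exact: (@finite_finset T).
Qed.

(** Compactness of the full shift, in the form of a cluster point: it is used to
    pass from words desubstituted on longer and longer windows to a sequence. *)
Lemma koenig (T : finType) (y : nat -> int -> T) :
  exists x : int -> T, forall r m, exists2 k, (m <= k)%N & agree r x (y k).
Proof.
have [|x [_ xy]] := @ptws_compact T (y @ \oo) _; first exact: filterT.
exists x => r m.
have [||_ [[k mk <-] xyk]] := xy (y @` [set k | (m <= k)%N]) (agree r x).
- by exists m => // k mk; exists k.
- exact: near_agree_ptws.
- by exists k.
Qed.

Section SubshiftTopology.
Variables (A : finType) (phi : substitution A).

Lemma near_agree (w : subshift phi) r : \forall w' \near w, agree r (val w) (val w').
Proof.
exact: (@initial_continuous _ _ (@set_val _ (subshift phi)) w _ (near_agree_ptws _ r)).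
Qed.

Lemma locally_constant_continuous (Z : topologicalType) (F : subshift phi -> Z) :
  (forall w, exists r, forall w', agree r (val w) (val w') -> F w = F w') ->
  continuous F.
Proof.
move=> Fr w U UF; have [r wr] := Fr w.
apply: (@filterS _ (nbhs w)) (near_agree w r) => w' /wr e; rewrite /= -e.
exact: nbhs_singleton.
Qed.

Lemma subshift_closed : closed (subshift phi).
Proof.
move=> w wX i m.
have [w' [w'X ww']] := wX _ (near_agree_ptws w (`|i| + m)%N).
rewrite (agree_window _ _ ww'); first exact: w'X.
all: lia.
Qed.

Lemma subshift_compact : compact [set: subshift phi].
Proof.
apply: compact_set_type; apply: subclosed_compact (@ptws_compact A) _ => //.
exact: subshift_closed.
Qed.

Lemma continuous_subshift (T : topologicalType) (F : T -> subshift phi) :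
  (forall i, continuous (fun x => val (F x) i : discrete_topology A)) -> continuous F.
Proof. by move=> cF; apply: continuous_comp_initial; exact: continuous_ptws. Qed.

End SubshiftTopology.

Section BlockMaps.
Variables (A : finType) (phi : substitution A).

(** The shift, the substitution and the collaring all compute each letter of the
    image from finitely many letters of the argument. *)
Lemma block_map_continuous (B : finType) (psi : substitution B)
    (F : subshift psi -> subshift phi) :
  (forall i w, exists r, forall w', agree r (val w) (val w') -> val (F w) i = val (F w') i) ->
  continuous F.
Proof.
move=> Fr; apply: continuous_subshift => i.
by apply: (@locally_constant_continuous _ psi (discrete_topology A)) => w; exact: Fr.
Qed.

Lemma shiftX_continuous k : continuous (@shiftX A phi k).
Proof.
apply: block_map_continuous => i w; exists `|(i + k)%R|%N => w' ww'.
by rewrite /= /shift; apply: ww'.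
Qed.

Lemma agree_subst (w w' : int -> A) (i : int) :
  agree `|i|.+1 w w' -> subst_bi phi w i = subst_bi phi w' i.
Proof.
move=> ww'; have E j m : (`|j| <= `|i|.+1)%N -> (`|(j + m%:Z)%R| <= `|i|.+1)%N ->
  window w j m = window w' j m by move=> *; exact: agree_window ww'.
case: i E ww' => k E ww' /=.
  by rewrite E ?(ww' 0)//; lia.
by rewrite E ?(ww' 0)//; lia.
Qed.

Lemma substX_continuous : continuous (@substX A phi).
Proof.
apply: block_map_continuous => i w; exists `|i|.+1 => w' ww' /=.
exact: agree_subst.
Qed.

End BlockMaps.

Section Words.
Variables (A : Type) (phi : substitution A).

(** The amount m depends on w.  This is the combinatorial reason why the
    substitution map sends flow orbits to flow orbits. *)
Lemma subst_bi_shift_ex k (w : int -> A) :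
  exists m, subst_bi phi (shift k w) = shift m (subst_bi phi w).
Proof.
case: k => k.
  exists (size (subst_word phi (window w 0 k)))%:Z.
  by apply/funext => i; rewrite subst_bi_shift.
exists (- (size (subst_word phi (window w (- k.+1%:Z) k.+1)))%:Z).
by apply/funext => i; rewrite NegzE -subst_bi_shiftN.
Qed.

End Words.

(** * Topology of the tiling space *)

Section Quotient.
Variables (T : topologicalType) (r : T -> T -> Prop).

Lemma quotient_by_eq_lift (Z : Type) (g : T -> Z) x y :
  (forall x y, r x y -> g x = g y) ->
  \pi_(quotient_by r) x = \pi_(quotient_by r) y -> g x = g y.
Proof.
by move=> rg xy; rewrite -(quotient_by_lift rg x) xy quotient_by_lift.
Qed.

Lemma quotient_by_pi_continuous : continuous (\pi_(quotient_by r) : T -> quotient_by r).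
Proof. exact: pi_continuous. Qed.

Lemma quotient_by_continuous (Z : topologicalType) (F : quotient_by r -> Z) (g : T -> Z) :
  (forall x, F (\pi_(quotient_by r) x) = g x) -> continuous g -> continuous F.
Proof.
move=> Fg cg; apply/(@quotient_continuous _ {eq_quot (gen_equiv r)}).
by rewrite (_ : _ \o _ = g)//; apply/funext.
Qed.

Lemma quotient_by_factor (Z : topologicalType) (g : T -> Z) :
  (forall x y, r x y -> g x = g y) -> continuous g ->
  exists2 F : quotient_by r -> Z, continuous F & forall x, F (\pi_(quotient_by r) x) = g x.
Proof.
move=> rg cg; exists (fun x => g (repr x)); last exact: quotient_by_lift.
exact: quotient_by_continuous (quotient_by_lift rg) cg.
Qed.

Lemma quotient_by_compact : compact [set: T] -> compact [set: quotient_by r].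
Proof.
move=> cT; rewrite (_ : setT = \pi_(quotient_by r) @` setT).
  apply: continuous_compact => //; apply: continuous_subspaceT.
  exact: quotient_by_pi_continuous.
by apply/seteqP; split=> // x _; exists (repr x) => //; exact: reprK.
Qed.

End Quotient.

Section TilingTopology.
Variables (R : realType) (A : finType) (phi : substitution A).
Local Notation Om := (tiling_space R phi).
Implicit Types (w : subshift phi) (t : `[0 : R, 1]%classic).

Lemma itv01P t : 0 <= val t <= 1.
Proof. by have := set_valP t; rewrite /= in_itv. Qed.

Lemma tiling_space_compact : compact [set: Om].
Proof.
apply: quotient_by_compact; rewrite -setXTT.
apply: compact_setX; first exact: subshift_compact.
apply: compact_set_type; exact: segment_compact.
Qed.

(** The normal form of (w, 1) is (sigma w, 0); it is constant on the classes of
    the gluing relation, so coordinates with t < 1 are unique. *)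
Lemma tiling_pi_inj w w' t t' : val t < 1 -> val t' < 1 ->
  \pi_Om (w, t) = \pi_Om (w', t') -> w = w' /\ t = t'.
Proof.
pose nf (x : suspension R phi) : (int -> A) * R :=
  if val x.2 < 1 then (val x.1, val x.2) else (shift 1 (val x.1), 0).
move=> t1 t1' /(@quotient_by_eq_lift _ _ _ nf).
have /[swap]/[apply] : forall x y, glue x y -> nf x = nf y.
  by move=> [u s] [v s'] [/= s1 vu s'0]; rewrite /nf /= s1 s'0 ltxx ltr01 vu.
by rewrite /nf /= t1 t1' => -[ww' tt']; split; apply: val_inj.
Qed.

Section Separation.
Variable u : subshift phi -> R.

(** A function u on the subshift gives two kinds of functions on the suspension
    that respect the gluing.  The bump vanishes at both ends of each tile, and
    also at the height c; the interpolation goes linearly from u(w) to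
    u(sigma w) along the tile. *)
Definition bump (c : R) (x : suspension R phi) : R :=
  u x.1 * (val x.2 * (1 - val x.2) * (val x.2 - c)).

Definition interpolation (x : suspension R phi) : R :=
  (1 - val x.2) * u x.1 + val x.2 * u (shiftX 1 x.1).

Hypothesis cu : continuous u.

Let c1 : continuous (fun x : suspension R phi => u x.1).
Proof. by move=> x; apply: continuous_comp; [exact: cvg_fst|exact: cu]. Qed.

Let c2 : continuous (fun x : suspension R phi => val x.2 : R).
Proof.
move=> x; apply: continuous_comp; first exact: cvg_snd.
exact: (@initial_continuous _ _ (@set_val _ `[0 : R, 1]%classic)).
Qed.

Lemma bump_continuous c : continuous (bump c).
Proof.
move=> x; apply: cvgM; first exact: c1.
apply: cvgM; first (apply: cvgM; first exact: c2); apply: cvgB;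
  try exact: c2; exact: cvg_cst.
Qed.

Lemma interpolation_continuous : continuous interpolation.
Proof.
move=> x; apply: cvgD; apply: cvgM.
- by apply: cvgB; [exact: cvg_cst|exact: c2].
- exact: c1.
- exact: c2.
apply: (@continuous_comp _ _ _ (fun x : suspension R phi => shiftX 1 x.1)); last exact: cu.
by apply: continuous_comp; [exact: cvg_fst|exact: shiftX_continuous].
Qed.

Lemma bump_glue c x y : glue x y -> bump c x = bump c y.
Proof. by move=> [x1 _ y0]; rewrite /bump x1 y0 subrr !(mulr0, mul0r). Qed.

Lemma interpolation_glue x y : glue x y -> interpolation x = interpolation y.
Proof.
move=> [x1 xy y0]; rewrite /interpolation x1 y0 subrr subr0 !mul0r !mul1r add0r addr0.
by congr u; apply: val_inj.
Qed.

End Separation.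

Lemma indicator_continuous (P : set (subshift phi)) :
  (exists i, forall w w', val w i = val w' i -> P w -> P w') ->
  continuous (fun w => (`[< P w >])%:R : R).
Proof.
move=> [i Pi]; apply: locally_constant_continuous => w; exists `|i|%N => w' ww'.
congr (_ _)%:R; apply/asboolP/asboolP; apply: Pi; first exact: ww'.
by rewrite (ww' i).
Qed.

Lemma bump_neq0 (t : R) c : 0 < t < 1 -> t != c -> t * (1 - t) * (t - c) != 0.
Proof.
move=> /andP[t0 t1] tc; rewrite !mulf_neq0 ?subr_eq0//; first by rewrite gt_eqF.
by rewrite gt_eqF.
Qed.

(** Points at distinct heights are separated by a bump that vanishes at one of the
    two heights.  Points at the same height are distinguished by some letter: by
    a bump with the indicator of that letter if the height is positive, and by
    an interpolation if it is 0. *)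
Lemma tiling_space_hausdorff : hausdorff_space Om.
Proof.
apply: separated_hausdorff => x y.
have [w [t [-> t1]]] := tiling_spaceP x.
have [w' [t' [-> t1']]] := tiling_spaceP y.
have /andP[t0 _] := itv01P t; have /andP[t0' _] := itv01P t'.
pose u : subshift phi -> R := cst 1.
have cu : continuous u by exact: cst_continuous.
have sep (g : suspension R phi -> R) : (forall x y, glue x y -> g x = g y) ->
    continuous g -> g (w, t) <> g (w', t') ->
    exists (Y : topologicalType) (h : Om -> Y),
     [/\ hausdorff_space Y, continuous h & h (\pi_Om (w, t)) <> h (\pi_Om (w', t'))].
  move=> gg cg ne; have [F cF FE] := quotient_by_factor gg cg.
  by exists R, F; rewrite !FE; split => //; exact: Rhausdorff.
have [tt'|tt'] := eqVneq (val t) (val t').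
  move=> ne; have [i wi] : exists i, val w i <> val w' i.
    apply/existsNP => ww'; apply: ne; congr (\pi_Om (_, _)); apply: val_inj => //.
    exact/funext.
  pose v (z : subshift phi) : R := (`[< val z i = val w i >])%:R.
  have cv : continuous v.
    by apply: indicator_continuous; exists i => z z' ->.
  have vw : v w = 1 by rewrite /v asboolT.
  have vw' : v w' = 0 by rewrite /v asboolF//; exact: nesym.
  have [t00|tn0] := eqVneq (val t) 0.
    apply: (sep (interpolation v)).
    - exact: interpolation_glue.
    - exact: interpolation_continuous.
    rewrite /interpolation -[X in _ <> X]/((1 - val t') * v w' + val t' * v (shiftX 1 w')).
    rewrite -[X in X <> _]/((1 - val t) * v w + val t * v (shiftX 1 w)).
    rewrite -tt' t00 vw vw' !mul0r !subr0 !addr0 !mul1r.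
    by apply/eqP; exact: oner_neq0.
  apply: (sep (bump v 1)).
  - exact: bump_glue.
  - exact: bump_continuous.
  rewrite /bump /= vw vw' mul1r mul0r; apply/eqP; apply: bump_neq0.
    by rewrite lt_neqAle eq_sym tn0 t0 t1.
  by rewrite lt_eqF.
move=> _.
have [t00|tn0] := eqVneq (val t) 0.
  apply: (sep (bump u (val t))).
  - exact: bump_glue.
  - exact: bump_continuous.
  rewrite /bump /= !mul1r subrr mulr0; apply/nesym/eqP; apply: bump_neq0.
    rewrite t1' lt_neqAle t0' !andbT; move: tt'; apply: contra_neq => t0E.
    by rewrite t00.
  by rewrite eq_sym.
apply: (sep (bump u (val t'))).
- exact: bump_glue.
- exact: bump_continuous.
rewrite /bump /= !mul1r subrr mulr0; apply/eqP; apply: bump_neq0 => //.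
by rewrite lt_neqAle eq_sym tn0 t0 t1.
Qed.

End TilingTopology.

Lemma continuous_pair (T U V : topologicalType) (f : T -> U) (g : T -> V) :
  continuous f -> continuous g -> continuous (fun x => (f x, g x)).
Proof. by move=> cf cg x; exact: (cvg_pair (cf x) (cg x)). Qed.

(** * Topology of the Anderson-Putnam complex *)

Section ApTopology.
Variables (R : realType) (A : finType) (phi : substitution A).
Local Notation Om := (tiling_space R phi).
Local Notation Ga := (ap_complex R phi).
Implicit Types (w : subshift phi) (t : `[0 : R, 1]%classic).

(** For t = 1 the point is the end of the tile, that is a vertex, and two tiles with
    the same label have the same end because the label is read at index -1
    after a shift. *)
Lemma ap_point_eq0 w w' t : val w 0 = val w' 0 -> ap_point w t = ap_point w' t.
Proof.
move=> ww'; have /andP[t0] := itv01P t; rewrite le_eqVlt => /predU1P[t1|t1].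
  have e u : \pi_Om (u, t) = \pi_Om (shiftX 1 u, frac 0 : `[0 : R, 1]%classic).
    by apply: quotient_by_eq; split => //=; rewrite floor0 subrr.
  rewrite /ap_point !e; apply: quotient_by_eq.
  exists (shiftX 1 w), (shiftX 1 w'), (frac 0); split => //; first exact: frac_lt1.
  by right; split; [rewrite /= floor0 subrr|left; rewrite /= /shift addNr].
apply: quotient_by_eq; exists w, w', t; split => //.
have [t00|tn0] := eqVneq (val t) 0; first by right; split => //; right.
by left; split => //; rewrite lt_neqAle eq_sym tn0 t0.
Qed.

Lemma ap_point_eqN1 w w' t : val t = 0 -> val w (-1) = val w' (-1) ->
  ap_point w t = ap_point w' t.
Proof.
move=> t0 ww'; apply: quotient_by_eq; exists w, w', t; split => //.
  by rewrite t0.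
by right; split => //; left.
Qed.

(** The separating functions are those of the tiling space, with u depending on
    w_0 only.  Distinct vertices need the indicator of a vertex class: both ends
    of a tile are determined by its label, hence so is the interpolation. *)
Lemma ap_complex_hausdorff : hausdorff_space Ga.
Proof.
apply: separated_hausdorff => x y.
rewrite -[x]reprK -[y]reprK.
have [w [t [-> t1]]] := tiling_spaceP (repr x).
have [w' [t' [-> t1']]] := tiling_spaceP (repr y).
rewrite -!/(ap_point _ _).
have /andP[t0 _] := itv01P t; have /andP[t0' _] := itv01P t'.
have sep (g : suspension R phi -> R) : (forall x y, glue x y -> g x = g y) ->
    (forall z z' s, val z 0 = val z' 0 -> g (z, s) = g (z', s)) ->
    (forall z z' s, val s = 0 -> val z (-1) = val z' (-1) -> g (z, s) = g (z', s)) ->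
    continuous g -> g (w, t) <> g (w', t') ->
    exists (Y : topologicalType) (h : Ga -> Y),
     [/\ hausdorff_space Y, continuous h & h (ap_point w t) <> h (ap_point w' t')].
  (* g descends first to the tiling space, then to the complex *)
  move=> gg g0 g1 cg ne; have [F cF FE] := quotient_by_factor gg cg.
  have rF x1 y1 : ap_rel x1 y1 -> F x1 = F y1.
    move=> [z [z' [s [-> -> _ h]]]]; rewrite !FE.
    by case: h => [[_ /g0->//]|[s0 [/g1->//|/g0->//]]].
  have [H cH HE] := quotient_by_factor rF cF.
  by exists R, H; rewrite !HE !FE; split => //; exact: Rhausdorff.
pose v0 (z u : subshift phi) : R := (`[< val u 0 = val z 0 >])%:R.
have sepb c (z : subshift phi) : bump (v0 z) c (w, t) <> bump (v0 z) c (w', t') ->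
    exists (Y : topologicalType) (h : Ga -> Y),
     [/\ hausdorff_space Y, continuous h & h (ap_point w t) <> h (ap_point w' t')].
  apply: sep.
  - exact: bump_glue.
  - by move=> a a' s aa'; rewrite /bump /v0 /= aa'.
  - by move=> a a' s s0 _; rewrite /bump s0 !mul0r !mulr0.
  - apply: bump_continuous; apply: indicator_continuous; exists 0.
    by move=> a a' ->.
have vE z : v0 z z = 1 by rewrite /v0 asboolT.
have [t00|tn0] := eqVneq (val t) 0.
  have [t00'|tn0'] := eqVneq (val t') 0.
    have tt' : t = t' by apply: val_inj; rewrite t00 t00'.
    move=> ne.
    pose v u : R := (`[< ap_point u t = ap_point w t >])%:R.
    apply: (sep (interpolation v)).
    - exact: interpolation_glue.
    - move=> z z' s zz'; rewrite /interpolation /v (ap_point_eq0 _ zz').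
      by rewrite (@ap_point_eqN1 (shiftX 1 z) (shiftX 1 z'))//= /shift addNr.
    - move=> z z' s s0 zz'; rewrite /interpolation s0 !mul0r !addr0.
      by rewrite /v (ap_point_eqN1 t00 zz').
    - apply: interpolation_continuous; apply: indicator_continuous; exists 0.
      by move=> z z' /ap_point_eq0 ->.
    rewrite -[X in _ <> X]/((1 - val t') * v w' + val t' * v (shiftX 1 w')).
    rewrite -[X in X <> _]/((1 - val t) * v w + val t * v (shiftX 1 w)).
    rewrite t00' t00 !mul0r !subr0 !addr0 !mul1r /v asboolT// asboolF; last first.
      by move=> /esym; rewrite [in X in _ = X -> _]tt'.
    by apply/eqP; exact: oner_neq0.
  move=> _; apply: (sepb (val t) w').
  rewrite /bump subrr !mulr0 vE mul1r; apply/nesym/eqP; apply: bump_neq0.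
    by rewrite t1' lt_neqAle t0' eq_sym tn0'.
  by rewrite [X in _ != X]t00.
have tgt0 : 0 < val t < 1 by rewrite t1 lt_neqAle t0 eq_sym tn0.
have [tt'|tt'] := eqVneq (val t) (val t'); last first.
  move=> _; apply: (sepb (val t') w).
  by rewrite /bump subrr !mulr0 vE mul1r; apply/eqP; exact: bump_neq0.
have ttE : t = t' by exact: val_inj.
move=> ne; apply: (sepb 1 w).
rewrite /bump vE mul1r {1}/v0 asboolF ?mul0r.
  by apply/eqP; apply: bump_neq0 => //; rewrite lt_eqF.
by move=> ww'; apply: ne; rewrite -ttE; apply: ap_point_eq0.
Qed.

End ApTopology.

Section CollaredTopology.
Variables (R : realType) (A : finType) (phi : substitution A) (b : A) (n : nat).
Local Notation Om := (tiling_space R phi).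
Implicit Types (w : subshift phi) (t : `[0 : R, 1]%classic).

Lemma collared_wordX_continuous : continuous (@collared_wordX A phi b n).
Proof.
apply: block_map_continuous => i w; exists (`|i| + n).+1 => w' ww'.
apply: val_inj; rewrite /=; apply: val_inj; rewrite /= !collarE.
apply: agree_window ww'; lia.
Qed.

Lemma ap_projE w t : ap_proj b n (\pi_Om (w, t)) = ap_point (collared_wordX b n w) t.
Proof. by rewrite /ap_proj collar_isoE. Qed.

Lemma ap_proj_continuous : continuous (@ap_proj R A phi b n).
Proof.
apply: (@quotient_by_continuous _ _ _ _ (fun x => ap_point (collared_wordX b n x.1) x.2)).
  by case=> w t; exact: ap_projE.
pose lift (x : suspension R phi) : suspension R (collared_subst phi b n) :=
  (collared_wordX b n x.1, x.2).
move=> x; apply: (@continuous_comp _ _ _ (fun x => \pi_(tiling_space _ _) (lift x)));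
  last exact: quotient_by_pi_continuous.
apply: (@continuous_comp _ _ _ lift); last exact: quotient_by_pi_continuous.
apply: continuous_pair => y; last exact: cvg_snd.
by apply: (@continuous_comp _ _ _ fst); [exact: cvg_fst|exact: collared_wordX_continuous].
Qed.


(** Thanks to this overlap the 2n letters around a vertex can be read off the
    collared letter on either side of it. *)
Lemma take_collared_word (z : subshift (collared_subst phi b n)) i :
  take (2 * n) (val (val z (i + 1))) = behead (val (val z i)).
Proof.
have [w <-] := collared_wordX_surj z; rewrite /= !collarE.
rewrite (_ : (2 * n).+1 = 2 * n + 1)%N; last lia.
rewrite {1}windowD take_size_cat ?size_window//.
rewrite addnC windowD window1 /=; congr window; lia.
Qed.

(** In the interior of an edge p remembers the collared letter at 0.  At a vertex
    it only remembers the collared letter at -1 or at 0, up to transitive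
    closure; both contain the 2n letters around the vertex, which are therefore
    constant on the class. *)
Lemma ap_proj_inj w w' t t' : val t < 1 -> val t' < 1 ->
  ap_proj b n (\pi_Om (w, t)) = ap_proj b n (\pi_Om (w', t')) ->
  [/\ t = t', window (val w) (- n%:Z) (2 * n) = window (val w') (- n%:Z) (2 * n) &
      0 < val t -> window (val w) (- n%:Z) (2 * n).+1 = window (val w') (- n%:Z) (2 * n).+1].
Proof.
move=> t1 t1'; rewrite !ap_projE.
(* normal form of a point, with the letters that its class determines *)
pose D0 (x : suspension R (collared_subst phi b n)) : R * seq A :=
  if val x.2 < 1 then
    (val x.2, if 0 < val x.2 then val (val (val x.1 0)) else take (2 * n) (val (val x.1 0)))
  else (0, behead (val (val x.1 0))).
have D0g x y : glue x y -> D0 x = D0 y.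
  move: x y => [z s] [z' s'] [/= s1 zz' s'0].
  by rewrite /D0 /= s1 s'0 !ltxx ltr01 zz' -take_collared_word.
pose D (x : tiling_space R (collared_subst phi b n)) := D0 (repr x).
have DE x : D (\pi_(tiling_space R (collared_subst phi b n)) x) = D0 x.
  exact: (quotient_by_lift D0g).
have Dr x y : ap_rel x y -> D x = D y.
  move=> [z [z' [s [-> -> s1 h]]]]; rewrite !DE /D0 /= s1.
  case: h => [[s0 zz']|[s0 [zz'|zz']]]; first by rewrite zz'.
    rewrite s0 ltxx; have := (take_collared_word z (-1), take_collared_word z' (-1)).
    by rewrite addNr => -[-> ->]; rewrite zz'.
  by rewrite zz'.
move=> /(quotient_by_eq_lift Dr); rewrite !DE /D0 /= t1 t1'.
have tw u : take (2 * n) (collar n (val u) 0) = window (val u) (- n%:Z) (2 * n).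
  rewrite collarE add0r (_ : (2 * n).+1 = 2 * n + 1)%N; last lia.
  by rewrite windowD take_size_cat ?size_window.
move=> -[tt']; have {}tt' : t = t' by exact: val_inj.
rewrite -tt' -!tw !collarE !add0r.
case: ltP => h e; first by split => //; rewrite e.
by split.
Qed.

End CollaredTopology.

(** * The substitution map is continuous *)

Section PositionContinuity.
Variables (R : realType) (A : finType) (phi : substitution A).
Local Notation Om := (tiling_space R phi).
Implicit Types (w : subshift phi) (t : `[0 : R, 1]%classic).

Fact clamp_proof (s : R) : `[0 : R, 1]%classic (Order.max 0 (Order.min 1 s)).
Proof. by rewrite /= in_itv /= le_max lexx /= ge_max ler01 ge_min lexx. Qed.

Definition clamp (s : R) : `[0 : R, 1]%classic := SigSub (mem_set (clamp_proof s)).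

Lemma clamp_id s : 0 <= s <= 1 -> val (clamp s) = s.
Proof. by move=> /andP[s0 s1] /=; rewrite min_r// max_r. Qed.

Lemma clamp_continuous : continuous clamp.
Proof.
apply: continuous_comp_initial => s; rewrite /comp /=.
apply: (@continuous_max R R (cst 0)); first exact: cvg_cst.
by apply: (@continuous_min R R (cst 1)); [exact: cvg_cst|exact: cvg_id].
Qed.

(** On the k-th tile the flow from (w, 0) is given by a formula without floor,
    which the clamping extends to a continuous function of all times. *)
Definition tile_piece (k : int) (x : subshift phi * R) : Om :=
  \pi_Om (shiftX k x.1, clamp (x.2 - k%:~R)).

Lemma tile_piece_continuous k : continuous (tile_piece k).
Proof.
pose lift (x : subshift phi * R) : suspension R phi := (shiftX k x.1, clamp (x.2 - k%:~R)).
move=> x; apply: (@continuous_comp _ _ _ lift); last exact: quotient_by_pi_continuous.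
apply: continuous_pair => y.
  by apply: (@continuous_comp _ _ _ fst); [exact: cvg_fst|exact: shiftX_continuous].
apply: (@continuous_comp _ _ _ (fun y : subshift phi * R => y.2 - k%:~R)); last exact: clamp_continuous.
by apply: cvgB; [exact: cvg_snd|exact: cvg_cst].
Qed.

Lemma pi_position w (k : int) t :
  \pi_Om (position w (k%:~R + val t)) = \pi_Om (shiftX k w, t).
Proof.
have /andP[t0] := itv01P t; rewrite le_eqVlt => /predU1P[t1|t1].
  have e : Num.floor (k%:~R + val t) = k + 1.
    by rewrite t1 -[X in _ + X]/(1%:~R) -intrD intrKfloor.
  rewrite /position e; apply/esym/quotient_by_eq; split => //=.
    by rewrite shiftD addrC.
  by rewrite e t1 intrD subrr.
have e : Num.floor (k%:~R + val t) = k.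
  by apply: floor_def; rewrite lerDl t0 intrD ltrD2l.
by rewrite /position e; congr (\pi_Om (_, _)); apply: val_inj; rewrite /= e addrC addKr.
Qed.

Lemma position_tile_piece k w s : k%:~R <= s <= k%:~R + 1 ->
  \pi_Om (position w s) = tile_piece k (w, s).
Proof.
move=> /andP[ks sk].
have c : val (clamp (s - k%:~R)) = s - k%:~R.
  by apply: clamp_id; rewrite subr_ge0 ks lerBlDr addrC.
have := pi_position w k (clamp (s - k%:~R)).
by rewrite c addrC subrK.
Qed.

(** The floor in the definition of the position jumps at integer times.  Near
    any time only two adjacent tiles are met; each of them is a closed condition
    on the time, and on each the position is a continuous piece. *)
Lemma position_continuous :
  continuous (fun x : subshift phi * R => \pi_Om (position x.1 x.2)).
Proof.
move=> [w s] U /= UF.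
have near_piece k : \forall x \near (w, s), k%:~R <= x.2 <= k%:~R + 1 -> U (tile_piece k x).
  have [ks|ks] := boolP (k%:~R <= s <= k%:~R + 1).
    have := @tile_piece_continuous k (w, s) U.
    rewrite -position_tile_piece// => /(_ UF).
    by move=> H; apply: (@filterS _ (nbhs (w, s)) _ _ _ _ H) => x Ux _.
  have cl : closed [set x : subshift phi * R | k%:~R <= x.2 <= k%:~R + 1].
    rewrite (_ : mkset _ = snd @^-1` `[k%:~R, k%:~R + 1]%classic); last first.
      by apply/seteqP; split => x; rewrite /= in_itv.
    apply: (@preimage_closed (subshift phi * R)%type R); last exact: itv_closed.
    by move=> x _; exact: cvg_snd.
  have : nbhs (w, s) (~` [set x : subshift phi * R | k%:~R <= x.2 <= k%:~R + 1]).
    apply: open_nbhs_nbhs; split; first exact: closed_openC.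
    exact/negP.
  by move=> H; apply: (@filterS _ (nbhs (w, s)) _ _ _ _ H) => x nx /nx.
pose k := Num.floor s.
have sk : \forall x \near (w, s), k%:~R - 1 < x.2 < k%:~R + 1.
  have : nbhs s `]k%:~R - 1, k%:~R + 1[%classic.
    apply: open_nbhs_nbhs; split; first exact: itv_open.
    rewrite /= in_itv /=; apply/andP; split.
      by rewrite ltrBlDr (le_lt_trans (floor_le s))// ltrDl.
    by rewrite -[X in _ + X]/(1%:~R) -intrD floorD1_gt.
  move=> /(@cvg_snd _ _ (nbhs w) (nbhs s)) H; apply: (@filterS _ (nbhs (w, s)) _ _ _ _ H) => x /=.
  by rewrite in_itv.
have H := filterI sk (filterI (near_piece k) (near_piece (k - 1)));
have {}H := H (nbhs_filter _) (nbhs_filter _).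
have : nbhs (w, s) (fun x => U (\pi_Om (position x.1 x.2))); last by [].
apply: (@filterS _ (nbhs (w, s)) _ _ _ _ H) => -[w' s'] /= [/andP[s1 s2] [U1 U2]].
have [ks|sk'] := leP k%:~R s'.
  by rewrite (@position_tile_piece k); [apply: U1|]; rewrite ks ltW.
have e : (k - 1)%:~R <= s' <= (k - 1)%:~R + 1 by rewrite intrD subrK !ltW.
by rewrite (@position_tile_piece (k - 1))//; exact: U2.
Qed.

Lemma tiling_map_continuous : continuous (@tiling_map R A phi).
Proof.
apply: (@quotient_by_continuous _ (@glue R A phi) Om _ (fun x => \pi_Om
  (position (substX x.1) ((size (phi (val x.1 0)))%:R * val x.2)))).
  by case=> w t; exact: tiling_mapE.
pose g (x : suspension R phi) := (substX x.1, (size (phi (val x.1 0)))%:R * val x.2 : R).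
have cg : continuous g.
  apply: continuous_pair => x.
    by apply: (@continuous_comp _ _ _ fst); [exact: cvg_fst|exact: substX_continuous].
  apply: cvgM.
    apply: (@continuous_comp _ _ _ fst (fun w : subshift phi => (size (phi (val w 0)))%:R : R));
      first exact: cvg_fst.
    apply: locally_constant_continuous => w; exists 0%N => w' ww'.
    by rewrite (ww' 0).
  apply: (@continuous_comp _ _ _ snd); first exact: cvg_snd.
  exact: (@initial_continuous _ _ (@set_val _ `[0 : R, 1]%classic)).
by move=> x; exact: (continuous_comp (cg x) (@position_continuous (g x))).
Qed.

End PositionContinuity.

(** * Desubstitution *)

Section Desubstitution.
Variables (A : finType) (phi : substitution A).

Lemma block_position (x0 : A) u P : (P < size (subst_word phi u))%N ->
  exists q j, [/\ (q < size u)%N, (j < size (phi (nth x0 u q)))%N &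
                  P = (size (subst_word phi (take q u)) + j)%N].
Proof.
elim: u P => // a u IH P; rewrite /subst_word /= size_cat => Pu.
have [Pa|aP] := ltnP P (size (phi a)); first by exists 0%N, P.
have [|q [j [qu jq PE]]] := IH (P - size (phi a))%N; first by rewrite /subst_word; lia.
exists q.+1, j; split => //=; rewrite size_cat -addnA -/(subst_word _ _).
by move: PE aP; clear; lia.
Qed.

Definition max_image := \max_a size (phi a).

Lemma size_subst_word_le u : (size (subst_word phi u) <= size u * max_image)%N.
Proof.
rewrite /subst_word; elim: u => //= a u IH; rewrite size_cat mulSn leq_add//.
exact: (leq_bigmax (F := fun a => size (phi a))).
Qed.

(** A window of w of length at least 2 is a subword of phi(u) for some admitted u.
    The sequence y extends u arbitrarily on both sides, its index 0 being the
    letter of u whose image covers the index 0 of w.  Since images have length at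
    most [max_image], a long window of w forces u to be long on both sides of
    that letter, so that the central part of y is admitted. *)
Lemma desubst_window w m : subshift phi w -> exists (y : int -> A) (j : nat),
  [/\ (j < size (phi (y 0)))%N,
      forall i : int, (`|i| <= m)%N -> w i = subst_bi phi y (i + j%:Z) &
      forall r i l, (r.+1 * max_image <= m)%N -> (`|i| <= r)%N ->
        (`|(i + l%:Z)%R| <= r)%N -> admitted phi (window y i l)].
Proof.
move=> wX; have [a [[|k] ak]] := wX (- m.+1%:Z) (2 * m.+1).+1.
  by have := size_infix ak; rewrite size_window /=; lia.
(* k = 0 is excluded since the window has more than one letter *)
have := ak; rewrite [iter _ _ _]/=; set u := iter k _ _ => /infixP[p [s us]].
have uadm : admitted phi u by exists a, k; exact: infix_refl.
(* the position in phi(u) of the letter of index 0 of w *)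
pose P := (size p + m.+1)%N.
have sE : (size (subst_word phi u) = size p + ((2 * m.+1).+1 + size s))%N.
  by rewrite us !size_cat size_window.
have [|q [j [qu jq PE]]] := @block_position a u P; first by rewrite sE /P; lia.
pose V (i : int) := nth a u `|i|%N.
have VE l : (l <= size u)%N -> window V 0 l = take l u.
  move=> lu; apply: (@eq_from_nth _ a); first by rewrite size_window size_takel.
  by move=> c; rewrite size_window => cl; rewrite nth_window ?nth_take.
have Vu : window V 0 (size u) = u by rewrite VE// take_size.
exists (shift q%:Z V), j; split.
- by rewrite /shift add0r.
- move=> i im; rewrite subst_bi_shift VE; last exact: ltnW.
  have -> : i + j%:Z + (size (subst_word phi (take q u)))%:Z = (size p + `|(i + m.+1%:Z)%R|)%N%:Z.
    by move: PE im; rewrite /P; clear; lia.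
  rewrite (@subst_bi_pos _ phi a _ (size u)) Vu; last by rewrite sE; move: im; clear; lia.
  rewrite us nth_cat ifF; last by rewrite ltnNge leq_addr.
  rewrite addKn nth_cat size_window ifT; last by move: im; clear; lia.
  rewrite nth_window; last by move: im; clear; lia.
  by congr w; move: im; clear; lia.
- move=> r i l rm ir ilr; apply: admitted_infix uadm; rewrite -[X in infix _ X]Vu.
  rewrite window_shift.
  have h1 : (P < q.+1 * max_image)%N.
    rewrite PE mulSn addnC -addSn leq_add//.
      apply: leq_trans jq _.
      exact: (leq_bigmax (F := fun a => size (phi a))).
    by apply: leq_trans (size_subst_word_le _) _; rewrite size_takel// ltnW.
  have h2 : (m.+1 <= (size u - q) * max_image)%N.
    rewrite -size_drop; apply: leq_trans (size_subst_word_le _).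
    have := sE; rewrite -{1}(cat_take_drop q u) subst_word_cat size_cat.
    by move: PE; rewrite /P; clear; lia.
  have rq : (r < q)%N.
    rewrite -ltnS -(@ltn_pmul2r max_image); last by case: (max_image) h1; lia.
    by apply: leq_ltn_trans rm _; apply: ltn_trans h1; rewrite /P; lia.
  have ruq : (r.+1 < size u - q)%N.
    rewrite -(@ltn_pmul2r max_image); last by case: (max_image) h1; lia.
    exact: leq_trans h2.
  by apply: infix_window; move: rq ruq ir ilr; clear; lia.
Qed.

Lemma substX_onto (w : subshift phi) : exists (v : subshift phi) (j : nat),
  (j < size (phi (val v 0)))%N /\ w = shiftX j%:Z (substX v).
Proof.
have wX := set_valP w.
have /choice[y /choice[j yj]] := fun m => @desubst_window _ m wX.
have jM m : (j m < max_image.+1)%N.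
  have [jm _ _] := yj m; rewrite ltnS; apply: leq_trans (ltnW jm) _.
  exact: (leq_bigmax (F := fun a => size (phi a))).
(* the offset j is carried along as a second, constant, component *)
have [x xy] := koenig (fun m (i : int) => (y m i, Ordinal (jM m))).
pose v i := (x i).1.
have vy r m : exists k, [/\ (m <= k)%N, agree r v (y k) & j k = (x 0).2].
  have [k mk xk] := xy r m; exists k; split => //; last by rewrite (xk 0).
  by move=> i ir; rewrite /v (xk i).
have vX : subshift phi v.
  move=> i l; have [k [mk xk _]] := vy (`|i| + l)%N ((`|i| + l).+1 * max_image)%N.
  have [_ _ /(_ (`|i| + l)%N)ad] := yj k.
  rewrite (agree_window _ _ xk); try lia.
  by apply: ad => //; lia.
exists (SigSub (mem_set vX)), (x 0).2; split.
  have [k [_ xk <-]] := vy 0%N 0%N.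
  by rewrite /= xk//; have [] := yj k.
apply: val_inj; apply/funext => i; rewrite /= /shift.
have [k [mk xk jk]] := vy `|(i + (x 0).2%:Z)%R|.+1 `|i|%N.
by have [_ /(_ i mk) wi _] := yj k; rewrite wi jk; apply/esym/agree_subst.
Qed.

End Desubstitution.

(** * Growth of legal words *)

Section IteratedWords.
Variables (A : Type) (phi : substitution A).
Implicit Types w : int -> A.

Lemma window_subst_biN w m (l := size (subst_word phi (window w (- m%:Z) m))) :
  window (subst_bi phi w) (- l%:Z) l = subst_word phi (window w (- m%:Z) m).
Proof.
rewrite -[- l%:Z]add0r -window_shift.
have -> : shift (- l%:Z) (subst_bi phi w) = subst_bi phi (shift (- m%:Z) w).
  by apply/funext => i; rewrite -subst_bi_shiftN.
have wE : window w (- m%:Z) m = window (shift (- m%:Z) w) 0 m.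
  by rewrite window_shift add0r.
by rewrite /l wE window_subst_bi.
Qed.

Lemma window_iter_substN k w m (l := size (iter k (subst_word phi) (window w (- m%:Z) m))) :
  window (iter k (subst_bi phi) w) (- l%:Z) l = iter k (subst_word phi) (window w (- m%:Z) m).
Proof.
rewrite {}/l; elim: k => [|k IH]; first by rewrite size_window.
rewrite !iterS; set u := iter k _ (window _ _ _) in IH *.
by have := window_subst_biN (iter k (subst_bi phi) w) (size u); rewrite IH.
Qed.

Lemma iter_subst_agree k w w' m (l := size (iter k (subst_word phi) (window w 0 m))) c :
  window w 0 m = window w' 0 m -> (c < l)%N ->
  iter k (subst_bi phi) w c%:Z = iter k (subst_bi phi) w' c%:Z.
Proof.
move=> ww' cl; have := window_iter_subst phi k w m; have := window_iter_subst phi k w' m.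
rewrite -ww' -/l => <- /(congr1 (fun s => nth (w 0) s c)).
by rewrite !nth_window// add0r.
Qed.

Lemma iter_subst_agreeN k w w' m
    (l := size (iter k (subst_word phi) (window w (- m%:Z) m))) c :
  window w (- m%:Z) m = window w' (- m%:Z) m -> (c <= l)%N -> (0 < c)%N ->
  iter k (subst_bi phi) w (- c%:Z) = iter k (subst_bi phi) w' (- c%:Z).
Proof.
move=> ww' cl c0; have := window_iter_substN k w m; have := window_iter_substN k w' m.
rewrite -ww' -/l => <- /(congr1 (fun s => nth (w 0) s (l - c)%N)).
have lc : (l - c < l)%N by move: cl c0; clear; lia.
have e : - l%:Z + (l - c)%N%:Z = - c%:Z by move: cl c0; clear; lia.
by rewrite !nth_window// e.
Qed.

Lemma size_iter_subst_word k k' u : (k <= k')%N ->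
  (size (iter k (subst_word phi) u) <= size (iter k' (subst_word phi) u))%N.
Proof.
move=> /subnK <-; elim: (k' - k)%N => // d; rewrite addSn iterS => h.
exact: leq_trans h (size_subst_word _ _).
Qed.

End IteratedWords.

Section Growth.
Variables (A : finType) (phi : substitution A).

Lemma size_bounded_legal u : tame phi -> bounded_legal phi u ->
  (size u <= max_bounded_legal phi)%N.
Proof.
move=> tm uB; rewrite /max_bounded_legal fsbig_finite//=.
by apply: (@leq_bigmax_seq _ _ xpredT size) => //; rewrite in_fset_set// inE.
Qed.

(** A legal word longer than all bounded legal words is unbounded, and the length
    of its images is nondecreasing; there are finitely many words of the given
    length, so the growth is uniform. *)
Lemma legal_growth r : tame phi -> exists K, forall k u, (K <= k)%N ->
  legal phi u -> size u = (1 + max_bounded_legal phi)%N ->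
  (r < size (iter k (subst_word phi) u))%N.
Proof.
move=> tm; pose N := (1 + max_bounded_legal phi)%N.
have /choice[K KP] (u : N.-tuple A) : exists K, legal phi u ->
    (r < size (iter K (subst_word phi) u))%N.
  have [ul|] := pselect (legal phi u); last by exists 0%N.
  apply: contrapT => /forallNP nK.
  suff /(size_bounded_legal tm) : bounded_legal phi u by rewrite size_tuple /N; lia.
  split => //; split; first by case: (tval u) (size_tuple u).
  by exists r => k; rewrite leqNgt; apply/negP => rk; apply: (nK k).
exists (\max_u K u) => k u Kk ul uN.
have uN' : size u == N by apply/eqP.
apply: leq_trans (KP (Tuple uN') ul) _; apply: size_iter_subst_word.
exact: leq_trans (leq_bigmax _) Kk.
Qed.

End Growth.

(** * Iterates of the substitution map *)

Section TilingDynamics.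
Variables (R : realType) (A : finType) (phi : substitution A).
Local Notation Om := (tiling_space R phi).
Local Notation Phi := (@tiling_map R A phi).
Implicit Types (w : subshift phi) (t : `[0 : R, 1]%classic).

Lemma floor_split (m : nat) (x : R) : 0 <= x < m%:R ->
  exists (j : nat) t, [/\ (j < m)%N, val t < 1 & x = j%:Z%:~R + val t].
Proof.
move=> /andP[x0 xm].
have f0 : 0 <= Num.floor x by rewrite floor_ge0.
have fm : Num.floor x < m%:Z by rewrite floor_lt_int.
exists `|Num.floor x|%N, (frac x); split; first by lia.
  exact: frac_lt1.
by rewrite gez0_abs//= addrC subrK.
Qed.

Lemma tiling_map_onto x : exists y, Phi y = x.
Proof.
have [w [t [-> t1]]] := tiling_spaceP x.
have [v [j [jv ->]]] := substX_onto w.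
have /andP[t0 _] := itv01P t.
set L : R := (size (phi (val v 0)))%:R.
have L0 : 0 < L by rewrite ltr0n subst_gt0.
have s01 : `[0 : R, 1]%classic ((j%:R + val t) / L).
  rewrite /= in_itv /= divr_ge0 ?addr_ge0// ?(ltW L0)//= ler_pdivrMr// mul1r.
  apply: (@le_trans _ _ (j.+1%:R)); last by rewrite ler_nat.
  by rewrite -natr1 lerD2l ltW.
exists (\pi_Om (v, SigSub (mem_set s01))).
by rewrite tiling_mapE -(pi_position (substX v) j%:Z t) [val (SigSub _)]/= mulrC divfK ?gt_eqF.
Qed.

Lemma val_iter_substX k w : val (iter k (@substX A phi) w) = iter k (subst_bi phi) (val w).
Proof. by elim: k => //= k <-. Qed.

Lemma iter_tiling_map_orbit k w t : exists (J : int) s,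
  iter k Phi (\pi_Om (w, t)) = \pi_Om (shiftX J (iter k (@substX A phi) w), s).
Proof.
elim: k => [|k [J [s IH]]].
  by exists 0, t; congr (\pi_Om (_, _)); apply: val_inj; rewrite /= shift0.
rewrite iterS IH tiling_mapE /position.
set W := iter k _ w; set j := Num.floor _; set s' := frac _.
have [m mE] := subst_bi_shift_ex phi J (val W).
exists (m + j), s'; congr (\pi_Om (_, _)); apply: val_inj.
by rewrite /= mE shiftD addrC.
Qed.

(** The displacement J and the height s only depend on the label w_0 and on t, and
    the displacement stays within the image of that label.  At height 0 nothing
    moves: this matters because at a vertex p remembers one letter less. *)
Lemma iter_tiling_map_pair k w w' t : val t < 1 -> val w 0 = val w' 0 ->
  exists (J : nat) s, [/\ iter k Phi (\pi_Om (w, t)) = \pi_Om (shiftX J%:Z (iter k (@substX A phi) w), s),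
    iter k Phi (\pi_Om (w', t)) = \pi_Om (shiftX J%:Z (iter k (@substX A phi) w'), s),
    (J < size (iter k (subst_word phi) [:: val w 0%R]))%N, val s < 1 &
    val t = 0 -> J = 0%N /\ val s = 0].
Proof.
move=> t1 ww'; elim: k => [|k [J [s [IH IH' Jk s1 t0]]]].
  exists 0%N, t; split => //.
    by congr (\pi_Om (_, _)); apply: val_inj; rewrite /= shift0.
  by congr (\pi_Om (_, _)); apply: val_inj; rewrite /= shift0.
rewrite !iterS IH IH' !tiling_mapE.
set W := iter k _ w; set W' := iter k _ w'.
set u := iter k _ [:: _] in Jk *.
have uE : window (val W) 0 (size u) = u.
  by rewrite val_iter_substX /u -(window1 (val w) 0) window_iter_subst.
have uE' : window (val W') 0 (size u) = u.
  by rewrite val_iter_substX /u ww' -(window1 (val w') 0) window_iter_subst.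
have WJ l : (l <= size u)%N -> window (val W) 0 l = window (val W') 0 l.
  move=> lu; have := etrans uE (esym uE'); rewrite -(subnKC lu) !windowD => /eqP.
  by rewrite eqseq_cat ?size_window// => /andP[/eqP].
set a := val W J%:Z.
have aE : val W' J%:Z = a.
  have := WJ _ Jk; move/(congr1 (fun s => nth a s J)).
  by rewrite !nth_window// add0r => <-.
rewrite /= /shift !add0r -/a aE.
have /andP[s0 _] := itv01P s.
have [|j [s' [ja s'1 E]]] := @floor_split (size (phi a)) ((size (phi a))%:R * val s).
  by rewrite mulr_ge0//= gtr_pMr// ltr0n subst_gt0.
rewrite E !pi_position.
exists (size (subst_word phi (window (val W) 0 J)) + j)%N, s'; split => //.
- congr (\pi_Om (_, _)); apply: val_inj; apply/funext => i.
  by rewrite /= /shift (@subst_bi_shift _ phi (val W) J) PoszD addrAC addrA.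
- congr (\pi_Om (_, _)); apply: val_inj; apply/funext => i.
  rewrite /= /shift (@subst_bi_shift _ phi (val W') J) WJ ?(ltnW Jk)// PoszD.
  by rewrite addrAC addrA.
- have uE2 : u = window (val W) 0 J ++ a :: window (val W) (J%:Z + 1) (size u - J.+1).
    rewrite -{1}uE (_ : size u = J + (1 + (size u - J.+1)))%N; last by move: Jk; clear; lia.
    by rewrite !windowD window1 add0r; congr (_ ++ _ :: window _ _ _); move: Jk; clear; lia.
  rewrite -/u uE2 subst_word_cat size_cat ltn_add2l /subst_word /= size_cat.
  exact: ltn_addr.
- move=> /t0[J0 s00]; move: E; rewrite s00 mulr0 => /esym/eqP.
  have /andP[s'0 _] := itv01P s'.
  rewrite paddr_eq0// => /andP[/eqP j0 /eqP->]; split => //.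
  rewrite J0 /=; move/eqP: j0; rewrite -[j%:Z%:~R]/(j%:R) pnatr_eq0 => /eqP->.
  by [].
Qed.

(** Unions of flow orbits, expressed in coordinates so as to avoid the
    reparametrization of time by the substitution map. *)
Definition saturated (L : set Om) :=
  forall w t J s, L (\pi_Om (w, t)) -> L (\pi_Om (shiftX J w, s)).

Lemma closed_invariant_saturated L : closed_invariant L -> saturated L.
Proof.
move=> [_ inv] w t J s Lwt.
(* the flow time from (w, t) to (shift J w, s) *)
rewrite -(inv (J%:~R + val s - val t)); exists (\pi_Om (w, t)) => //.
by rewrite flowE addrC subrK pi_position.
Qed.

Lemma saturated_preimage L k w t s : saturated L ->
  L (iter k Phi (\pi_Om (w, t))) -> L (iter k Phi (\pi_Om (w, s))).
Proof.
move=> sL; have [J [t' ->]] := iter_tiling_map_orbit k w t.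
have [J' [s' ->]] := iter_tiling_map_orbit k w s => /(sL _ _ (J' - J) s').
congr (L (\pi_Om (_, _))); apply: val_inj.
by rewrite /= shiftD subrK.
Qed.

End TilingDynamics.

(** * Border forcing *)

Section BorderForcing.
Variables (R : realType) (A : finType) (phi : substitution A) (b : A) (n : nat).
Local Notation Om := (tiling_space R phi).
Local Notation Phi := (@tiling_map R A phi).
Local Notation p := (@ap_proj R A phi b n).

(** Equality of the projections gives equal collars of n letters on both sides of
    the origin.  Their k-th images contain more than r letters and lie on both
    sides of the image of the tile at the origin, where the image points are.
    At a vertex the right-hand collar starts at the letter of index 0 itself. *)
Lemma border_forcing r k x x' : (0 < n)%N ->
  (forall u, legal phi u -> size u = n -> (r < size (iter k (subst_word phi) u))%N) ->
  p x = p x' -> exists v v' s, [/\ val s < 1, iter k Phi x = \pi_Om (v, s),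
    iter k Phi x' = \pi_Om (v', s) & agree r (val v) (val v')].
Proof.
move=> n0 grow.
have [w [t [-> t1]]] := tiling_spaceP x.
have [w' [t' [-> t1']]] := tiling_spaceP x'.
move=> /(ap_proj_inj t1 t1')[<- W1 W2].
have growW i : (r < size (iter k (subst_word phi) (window (val w) i n)))%N.
  apply: grow; last by rewrite size_window.
  by exists (val w); [exact: set_valP|exists i; rewrite size_window].
have [left right] : window (val w) (- n%:Z) n = window (val w') (- n%:Z) n /\
    window (val w) 0 n = window (val w') 0 n.
  move: W1; rewrite mul2n -addnn !windowD addNr => /eqP.
  by rewrite eqseq_cat ?size_window// => /andP[/eqP-> /eqP->].
have ww' : val w 0 = val w' 0.
  have := congr1 (fun s => nth (val w 0) s 0) right.
  by rewrite !nth_window// addr0.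
have [J [s [-> -> Jk s1 t0]]] := iter_tiling_map_pair k t1 ww'.
exists (shiftX J%:Z (iter k (@substX A phi) w)), (shiftX J%:Z (iter k (@substX A phi) w')), s.
split => // i ir; rewrite /= /shift !val_iter_substX.
have [iJ|iJ] := leP 0 (i + J%:Z); last first.
  rewrite (_ : i + J%:Z = - `|(i + J%:Z)%R|%N%:Z); last by move: iJ; clear; lia.
  apply: (iter_subst_agreeN left); last by move: iJ; clear; lia.
  by apply: leq_trans (ltnW (growW _)); move: ir iJ; clear; lia.
rewrite (_ : i + J%:Z = `|(i + J%:Z)%R|%N%:Z); last by move: iJ; clear; lia.
have [tt0|tn0] := eqVneq (val t) 0.
  apply: (iter_subst_agree right).
  apply: leq_trans (growW _); rewrite ltnS.
  by have [-> _] := t0 tt0; move: ir; clear; lia.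
have /W2 : 0 < val t by have /andP[h _] := itv01P t; rewrite lt_neqAle eq_sym tn0 h.
rewrite (_ : (2 * n).+1 = n + (1 + n))%N; last by clear; lia.
rewrite !(windowD _ _ n) addNr => /eqP; rewrite eqseq_cat ?size_window// => /andP[_ /eqP right1].
apply: (iter_subst_agree right1).
rewrite windowD iter_subst_cat size_cat window1.
set S1 := size _ in Jk *; set S2 := size _.
have rS : (r < S2)%N by exact: growW.
by move: Jk ir iJ rS; clear; lia.
Qed.

Lemma border_forcing_inj x x' : (0 < n)%N ->
  (forall r, exists K, forall k u, (K <= k)%N -> legal phi u -> size u = n ->
     (r < size (iter k (subst_word phi) u))%N) ->
  (forall K, exists k y y', [/\ (K <= k)%N, p y = p y', iter k Phi y = x & iter k Phi y' = x']) ->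
  x = x'.
Proof.
move=> n0 grow yy.
have xx r : exists v v' s, [/\ val s < 1, x = \pi_Om (v, s), x' = \pi_Om (v', s) & agree r (val v) (val v')].
  have [K KP] := grow r; have [k [y [y' [Kk pyy' <- <-]]]] := yy K.
  by apply: border_forcing => // u; exact: KP.
have [v [v' [s [s1 xv xv' _]]]] := xx 0%N.
suff vv' : v = v' by rewrite xv xv' vv'.
apply: val_inj; apply/funext => i.
have [u [u' [s' [s'1 e e' uu']]]] := xx `|i|%N.
have [vu _] := tiling_pi_inj s1 s'1 (esym (etrans (esym e) xv)).
have [vu' _] := tiling_pi_inj s1 s'1 (esym (etrans (esym e') xv')).
by rewrite vu vu'; apply: uu'.
Qed.

End BorderForcing.

(** * Backward orbits of subcomplexes *)

Lemma iter_image (T : Type) (f : T -> T) n (S : set T) :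
  iter n f @` S = iter n (fun S => f @` S) S.
Proof.
elim: n => [|n IH]; first exact: image_id.
by rewrite iterS -IH -image_comp.
Qed.

(** E is indexed backwards: each term determines all earlier ones.  Among more
    than #|C| consecutive terms beyond a given index two are equal, hence E has
    a period d <= #|C| up to that index; d depends on the index, but its multiple
    #|C|! does not. *)
Lemma backward_periodic (T : Type) (f : T -> T) (C : finType) (F : C -> T) (E : nat -> T) :
  (forall k, f (E k.+1) = E k) -> (forall k, exists c, E k = F c) ->
  forall k, E (k + (#|C|)`!)%N = E k.
Proof.
move=> fE /choice[c cE] k; set M := #|C|.
have iterE d j : iter d f (E (j + d)%N) = E j.
  by elim: d j => [|d IH] j; rewrite ?addn0// iterSr addnS fE IH.
pose m := (k + M`!)%N.
have /injectivePn[i [j ij cij]] : ~~ injectiveb (fun i : 'I_M.+1 => c (m + i)%N).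
  apply/injectiveP => /leq_card; rewrite card_ord -/M; lia.
wlog lij : i j ij cij / (i < j)%N.
  move=> H; have [lt|lt|e] := ltngtP i j.
  - exact: (H i j).
  - by apply: (H j i) => //; rewrite eq_sym.
  - by move: ij; rewrite (val_inj e) eqxx.
pose d := (j - i)%N.
have Ed l : (l <= m)%N -> E (l + d)%N = E l.
  move=> lm.
  have := iterE (m + i - l)%N l; rewrite (_ : l + (m + i - l) = m + i)%N; last lia.
  rewrite cE cij -cE => <-.
  rewrite -(iterE (m + i - l)%N (l + d)%N); congr (iter _ _ (E _)).
  by move: lij lm; rewrite /d; clear; lia.
have dM : (d %| M`!)%N.
  by apply: dvdn_fact; rewrite subn_gt0 lij /=; have := ltn_ord j; rewrite /d; lia.
have Eq q : (k + q * d <= m)%N -> E (k + q * d)%N = E k.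
  elim: q => [|q IH] qm; first by rewrite addn0.
  have h : (k + q * d <= m)%N by apply: leq_trans qm; rewrite leq_add2l leq_mul2r leqnSn orbT.
  by rewrite mulSn (addnC d) addnA Ed// IH.
by rewrite -(divnK dM) Eq// divnK.
Qed.

Section Main.
Variables (R : realType) (A : finType) (b : A) (phi : substitution A) (n : nat).
Local Notation Om := (tiling_space R phi).
Local Notation Ga := (collared_complex R phi b n).
Local Notation Phi := (@tiling_map R A phi).
Local Notation p := (@ap_proj R A phi b n).
Local Notation f := (@induced_map R A phi b n).
Local Notation letters := (collared_letter phi b n).

Definition level_complex (L : set Om) (k : nat) : set Ga :=
  p @` [set x | L (iter k Phi x)].

Definition edge_union (C : {set letters}) : set Ga :=
  \bigcup_(c in [set c | c \in C]) @ap_edge R letters (collared_subst phi b n) c.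

Lemma induced_map_proj x : f (p x) = p (Phi x).
Proof. exact: (congr1 (@^~ x) (induced_mapE R phi b n)). Qed.

Lemma iter_induced_map_proj k x : iter k f (p x) = p (iter k Phi x).
Proof. by elim: k => //= k ->; exact: induced_map_proj. Qed.

Lemma level_complexS L k : f @` level_complex L k.+1 = level_complex L k.
Proof.
apply/seteqP; split => [_ [_ [x Lx <-] <-]|_ [x Lx <-]].
  exists (Phi x); first by move: Lx; rewrite /= -iterSr.
  by rewrite induced_map_proj.
have [y yx] := tiling_map_onto x; exists (p y); last by rewrite induced_map_proj yx.
by exists y => //; rewrite /= -iterS iterSr yx.
Qed.

(** With one point of a tile the preimage of L contains the whole tile, so its
    projection contains the whole edge. *)
Lemma level_complex_edges L k : saturated L ->
  exists C : {set letters}, level_complex L k = edge_union C.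
Proof.
move=> sL.
pose P (c : letters) := exists w t, L (iter k Phi (\pi_Om (w, t))) /\
  val (collared_wordX b n w) 0 = c.
exists [set c | `[< P c >]]%SET; apply/seteqP; split.
  move=> _ [x Lx <-]; have [w [t [xE _]]] := tiling_spaceP x.
  exists (val (collared_wordX b n w) 0).
    by rewrite /= inE; apply/asboolP; exists w, t; rewrite -xE.
  by exists (collared_wordX b n w), t; rewrite xE ap_projE.
move=> x [c /=]; rewrite inE => /asboolP[w [t [Lw wc]]] [z [s [zc ->]]].
exists (\pi_Om (w, s)); first exact: saturated_preimage Lw.
by rewrite ap_projE; apply: ap_point_eq0; rewrite wc zc.
Qed.

Lemma level_complex_period L k : saturated L ->
  level_complex L (k + (#|{set letters}|)`!)%N = level_complex L k.
Proof.
move=> sL; apply: (@backward_periodic _ (fun S => f @` S) _ edge_union).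
  exact: level_complexS.
by move=> l; exact: level_complex_edges.
Qed.

(** The periodicity hypothesis places every sampled term in the same subcomplex
    [level_complex L 0]; surjectivity onto the inverse limit is a compactness
    argument, injectivity is border forcing. *)
Lemma inverse_limit_level_complex (L : set Om) m :
  (0 < n)%N -> (0 < m)%N -> recognisable R phi ->
  (forall r, exists K, forall k u, (K <= k)%N -> legal phi u -> size u = n ->
     (r < size (iter k (subst_word phi) u))%N) ->
  closed L -> (forall k, level_complex L (k + m)%N = level_complex L k) ->
  homeomorphic (inverse_limit (iter m f) (level_complex L 0)) L.
Proof.
move=> n0 m0 PhiI grow cL per.
have cOm := @tiling_space_compact R A phi.
have hGa := @ap_complex_hausdorff R letters (collared_subst phi b n).
have /choice[g gK] := @tiling_map_onto R A phi.
have Kg : cancel Phi g by move=> x; apply: PhiI; rewrite gK.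
have cg : continuous g.
  apply: continuous_inverse_compact Kg gK => //.
    exact: tiling_space_hausdorff.
  exact: tiling_map_continuous.
have cgk k : continuous (iter k g).
  elim: k => [|k IH] x; first exact: cvg_id.
  by rewrite /=; apply: continuous_comp; [exact: IH|exact: cg].
have gkK k : cancel (iter k g) (iter k Phi).
  by elim: k => // k IH x; rewrite iterSr iterS gK IH.
have Kgk k : cancel (iter k Phi) (iter k g).
  by elim: k => // k IH x; rewrite iterSr iterS Kg IH.
(* H x samples the projected backward orbit of x every m steps *)
pose H (x : Om) : {ptws nat -> Ga} := fun k => p (iter (m * k) g x).
have cH : continuous H.
  apply: continuous_ptws => k x.
  by apply: (@continuous_comp _ _ _ (iter (m * k) g)); [exact: cgk|exact: ap_proj_continuous].
have lev k : level_complex L (m * k)%N = level_complex L 0%N.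
  by elim: k => [|k IH]; rewrite ?muln0// mulnS addnC per.
apply: (homeomorphic_image cOm _ cH _ cL).
- exact: (@hausdorff_product _ (fun _ : nat => Ga)).
- move=> x x' xx'; apply: (border_forcing_inj n0 grow) => K.
  exists (m * K)%N, (iter (m * K) g x), (iter (m * K) g x'); split; rewrite ?gkK//.
    by rewrite leq_pmull.
  exact: (congr1 (@^~ K) xx').
apply/seteqP; split => [_ [x Lx <-] i|y yS].
  split; first by rewrite -(lev i); exists (iter (m * i) g x) => //=; rewrite gkK.
  by rewrite /H iter_induced_map_proj mulnS iterD gkK.
have /choice[z zP] k : exists z, L (iter (m * k) Phi z) /\ p z = y k.
  by have [+ _] := yS k; rewrite -(lev k) => -[z Lz <-]; exists z.
pose x_ k := iter (m * k) Phi (z k).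
have cptL : compact L by exact: subclosed_compact cL cOm _.
have [|x [Lx xcl]] := cptL (x_ @ \oo) _.
  by exists 0%N => // k _; have [] := zP k.
exists x => //; apply/funext => k.
(* the preimage of a point is closed, and contains x_ l for all l >= k *)
have cD : closed [set u | p (iter (m * k) g u) = y k].
  have : closed [set y k] by apply: accessible_closed_set1; exact: hausdorff_accessible.
  by apply: preimage_closed => // u _; apply: continuous_comp; [exact: cgk|exact: ap_proj_continuous].
apply: cD => B xB.
have [|_ [[l kl <-] Bl]] := xcl (x_ @` [set l | (k <= l)%N]) B _ xB.
  by exists k => // l kl; exists l.
exists (x_ l); split => //=.
rewrite /x_ -(subnK kl) addnC mulnDr iterD Kgk -iter_induced_map_proj.
rewrite (subnKC kl) (zP l).2.
have : forall d, iter (m * d) f (y (k + d)%N) = y k.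
  elim=> [|d IH]; first by rewrite muln0 addn0.
  by rewrite mulnS addnC iterD addnS (yS (k + d)%N).2.
by move=> /(_ (l - k)%N); rewrite subnKC.
Qed.

End Main.

Theorem theorem5p15 (R : realType) (A : finType) (b : A) (phi : substitution A)
    (N := (1 + max_bounded_legal phi)%N)
    (f := @induced_map R A phi b N) :
  tame phi -> recognisable R phi ->
  exists n : nat, (0 < n)%N /\
    forall L : set (tiling_space R phi), closed_invariant L ->
      exists S : set (collared_complex R phi b N),
        [/\ subcomplex S,
            iter n f @` S = S &
            homeomorphic (inverse_limit (iter n f) S) L].
Proof.
move=> tm rec; set n := (#|{set collared_letter phi b N}|)`!.
exists n; split; first exact: fact_gt0.
move=> L cL; pose E := @level_complex R A b phi N L.
have sL := closed_invariant_saturated cL.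
have per k : E (k + n)%N = E k.
  exact: level_complex_period.
exists (E 0%N); split.
- rewrite /E; have [C ->] := @level_complex_edges R A b phi N L 0%N sL.
  exists [set c | c \in C], set0; split; first exact: sub0set.
  by rewrite setU0.
- have H j k : iter j (fun S => f @` S) (E (k + j)%N) = E k.
    elim: j k => [|j IH] k; first by rewrite addn0.
    by rewrite iterSr addnS [X in iter _ _ X]level_complexS IH.
  by rewrite iter_image -{1}(per 0%N) H.
- apply: inverse_limit_level_complex => //.
  + by rewrite fact_gt0.
  + by move=> r; exact: legal_growth.
  + by case: cL.
Qed.
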